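(* Let $H$ be a real Hilbert space, $\mathbb B_H=\{x\in H:|x|<1\}$, let $K\ge1$, and let $F:\mathbb D\to\mathbb B_H$ be harmonic. Suppose that $F$ is $K$-quasiconformal at every point of $\mathbb D$ in the pointwise sense. Then, for all $z_0,z\in\mathbb D$, $$\mathrm{CK}_{\mathbb B_H}\bigl(F(z_0),F(z)\bigr)\le K\,d_{\mathbb D}(z_0,z).$$
   Context: $\mathbb D$ is the open unit disk in $\mathbb C$. A $C^2$ map $F:\mathbb D\to H$ is harmonic if $\Delta F=0$. $L_F(z)=\max_{|v|=1}|dF_zv|$, $\ell_F(z)=\min_{|v|=1}|dF_zv|$; $F$ is $K$-quasiconformal at $z$ in the pointwise sense if $0<\ell_F(z)\le L_F(z)\le K\ell_F(z)$. For $p\in\mathbb B_H$, $v\in H$, the infinitesimal Klein norm is $$\mathrm{CK}_{\mathbb B_H}(p;v)=\frac{\sqrt{(1-|p|^2)|v|^2+\langle p,v\rangle^2}}{1-|p|^2},$$ and $P_{\mathbb D}(z;v)=|v|/(1-|z|^2)$ for $z\in\mathbb D$, $v\in\mathbb R^2$. The path distances are $\mathrm{CK}_{\mathbb B_H}(p,q)=\inf_\gamma\int_0^1\mathrm{CK}_{\mathbb B_H}(\gamma(t);\gamma'(t))\,dt$ over piecewise $C^1$ curves $\gamma:[0,1]\to\mathbb B_H$ joining $p$ to $q$, and $d_{\mathbb D}(z_0,z)=\inf_\gamma\int_0^1P_{\mathbb D}(\gamma(t);\gamma'(t))\,dt$ over piecewise $C^1$ curves in $\mathbb D$ joining $z_0$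 to $z$; equivalently $d_{\mathbb D}(z_0,z)=\operatorname{arctanh}\left|\frac{z-z_0}{1-\overline{z_0}z}\right|$. *)

(* Defs.v *)
From Stdlib Require Import Reals.
From Coquelicot Require Import Coquelicot.
Open Scope R_scope.

(* [inner_self] makes the given complete norm the one induced by [inner];
   positive definiteness of [inner] then follows from [norm_eq_zero]. *)
Record RealHilbert := {
  hilbert_sort :> CompleteNormedModule R_AbsRing;
  inner : hilbert_sort -> hilbert_sort -> R;
  inner_sym : forall x y, inner x y = inner y x;
  inner_plus_l : forall x y z, inner (plus x y) z = inner x z + inner y z;
  inner_scal_l : forall (a : R) x y, inner (scal a x) y = a * inner x y;
  inner_self : forall x, inner x x = norm x ^ 2
}.
Arguments inner {_} _ _.

Definition unit_disk (z : C) : Prop := Cmod z < 1.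
Definition unit_ball (H : RealHilbert) (p : H) : Prop := norm p < 1.

(* Derivatives are over the reals: [C] is [R * R] throughout,
   and its real normed module [C_R_NormedModule] carries the Euclidean norm. *)

Definition is_derive_x {V : NormedModule R_AbsRing} (F : C -> V) (z : C) (l : V) :=
  is_derive (fun t : R => F (t, snd z)) (fst z) l.
Definition is_derive_y {V : NormedModule R_AbsRing} (F : C -> V) (z : C) (l : V) :=
  is_derive (fun t : R => F (fst z, t)) (snd z) l.

Definition C1_partials {V : NormedModule R_AbsRing}
    (D : C -> Prop) (F Fx Fy : C -> V) : Prop :=
  forall z, D z ->
    is_derive_x F z (Fx z) /\ is_derive_y F z (Fy z) /\
    continuous Fx z /\ continuous Fy z.

Definition harmonic_on {V : NormedModule R_AbsRing}
    (D : C -> Prop) (F : C -> V) : Prop :=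
  exists Fx Fy Fxx Fxy Fyx Fyy : C -> V,
    C1_partials D F Fx Fy /\
    C1_partials D Fx Fxx Fxy /\
    C1_partials D Fy Fyx Fyy /\
    forall z, D z -> plus (Fxx z) (Fyy z) = zero.

Definition is_maximum (S : R -> Prop) (m : R) : Prop :=
  S m /\ forall r, S r -> r <= m.
Definition is_minimum (S : R -> Prop) (m : R) : Prop :=
  S m /\ forall r, S r -> m <= r.

Definition stretches {V : NormedModule R_AbsRing} (dF : C -> V) (r : R) : Prop :=
  exists v : C, Cmod v = 1 /\ r = norm (dF v).

(* The differential [dF] of [F] at [z] is unique when it exists. *)
Definition quasiconformal_at {V : NormedModule R_AbsRing}
    (K : R) (F : C -> V) (z : C) : Prop :=
  exists (dF : C -> V) (l L : R),
    @filterdiff R_AbsRing C_R_NormedModule V F (locally z) dF /\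
    is_minimum (stretches dF) l /\
    is_maximum (stretches dF) L /\
    0 < l /\ l <= L /\ L <= K * l.

Definition within_segment (a b t : R) : (R -> Prop) -> Prop :=
  within (fun s => a <= s <= b) (locally t).

(* [g] is the derivative of [gamma] on the closed interval [a, b], one-sided at
   the endpoints, and is continuous there. *)
Definition C1_on_segment {V : NormedModule R_AbsRing}
    (gamma g : R -> V) (a b : R) : Prop :=
  forall t, a <= t <= b ->
    filterdiff gamma (within_segment a b t) (fun h => scal h (g t)) /\
    filterlim g (within_segment a b t) (locally (g t)).

(* [gamma'] is the velocity of [gamma] except at the finitely many break points,
   where it is arbitrary; this does not affect the length integral. *)
Definition piecewise_C1 {V : NormedModule R_AbsRing} (gamma gamma' : R -> V) : Prop :=
  exists (n : nat) (s : nat -> R),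
    s O = 0 /\ s n = 1 /\
    forall i, (i < n)%nat ->
      s i < s (S i) /\
      exists g : R -> V,
        C1_on_segment gamma g (s i) (s (S i)) /\
        forall t, s i < t < s (S i) -> gamma' t = g t.

Definition is_path_length {V : NormedModule R_AbsRing}
    (D : V -> Prop) (m : V -> V -> R) (p q : V) (l : R) : Prop :=
  exists gamma gamma' : R -> V,
    piecewise_C1 gamma gamma' /\
    (forall t, 0 <= t <= 1 -> D (gamma t)) /\
    gamma 0 = p /\ gamma 1 = q /\
    is_RInt (fun t => m (gamma t) (gamma' t)) 0 1 l.

(* The infimum is taken in [Rbar], where that of the empty set is [p_infty]. *)
Definition path_distance {V : NormedModule R_AbsRing}
    (D : V -> Prop) (m : V -> V -> R) (p q : V) : Rbar :=
  Glb_Rbar (is_path_length D m p q).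

Definition CK_norm {H : RealHilbert} (p v : H) : R :=
  sqrt ((1 - norm p ^ 2) * norm v ^ 2 + inner p v ^ 2) / (1 - norm p ^ 2).

Definition CK_dist {H : RealHilbert} (p q : H) : Rbar :=
  path_distance (unit_ball H) CK_norm p q.

Definition poincare_norm (z v : C) : R := Cmod v / (1 - Cmod z ^ 2).

Definition disk_dist (z0 z : C) : Rbar :=
  @path_distance C_R_NormedModule unit_disk poincare_norm z0 z.

(* Main.v *)
Require Import Defs.
From Stdlib Require Import Reals Lra Lia.
From Coquelicot Require Import Coquelicot.
Open Scope R_scope.

(** The theorem is the integrated form of the pointwise inequality
    [CK_norm (F z) (dF_z u) <= K * poincare_norm z u] ([klein_poincare_pointwise]):
    the image under [F] of a curve in the disk has a Klein length of at most [K]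
    times the Poincare length of the curve ([CK_path_image]), and one passes to
    infima.

    For the pointwise inequality, precompose [F] with a Moebius transformation so
    that the point is the origin; this divides out the Poincare density. Let [X]
    be the image under the differential of a least stretched unit direction and
    [Y] that of the direction at right angles. Then [X] and [Y] are orthogonal,
    [|X| <= |Y|], and the differential is bounded by [K |X|]
    ([quasiconformal_frame]). The plane through [q = F 0] spanned by [X] and [Y]
    cuts the unit ball in a round disk of some radius [c]; let [a] be the position
    of [q] in it, rescaled to the unit disk. The Klein norm at [q] of a vector [u]
    of the plane is at most [|u| / (c (1 - |a|^2))], so all reduces to the
    Schwarz-Pick bound [|X| <= c (1 - |a|^2)].

    That bound comes from an extremal map. The Moebius parametrization [g] of the
    slice with [g 0 = q] has [|g| = 1] on the unit circle, and multiplied by the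
    positive weight [w = |1 + conj a z|^2] it becomes on the circle a
    trigonometric polynomial of degree one. As [|F| < 1], the inner product of [F]
    with [w g] is at most [|w g| = w]. Averaged over a circle, this involves only
    the value and the differential of [F] at the origin, because [F] is harmonic
    ([harmonic_extremal_inequality]); written out, it is the bound
    ([extremal_slice_bound]).

    The averages are computed from [u_x - i u_y], which is holomorphic for a
    scalar component [u] of [F]. The Cauchy-Riemann equations express the radial
    derivative of a holomorphic function as an angular derivative, which has mean
    zero on circles; so circle means are constant ([holomorphic_mean]). The
    holomorphic class is stable under products and composition, which is how the
    Moebius transformation and the higher Fourier modes are handled. *)

(** * Calculus of C1 functions on the disk *)

Lemma unit_disk_sqr (x y : R) : unit_disk (x, y) <-> x ^ 2 + y ^ 2 < 1.
Proof.
  unfold unit_disk, Cmod; cbn [fst snd].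
  assert (0 <= x ^ 2 + y ^ 2) by nra.
  split; intro h.
  - rewrite <- (sqrt_sqrt (x ^ 2 + y ^ 2)) by assumption.
    pose proof (sqrt_pos (x ^ 2 + y ^ 2)); nra.
  - rewrite <- sqrt_1; apply sqrt_lt_1_alt; lra.
Qed.

Lemma unit_disk_open (z : C) : unit_disk z -> locally z unit_disk.
Proof.
  destruct z as [x y]; intro hz.
  apply unit_disk_sqr in hz.
  assert (hc : continuous (fun u : R * R => fst u * fst u + snd u * snd u) (x, y)).
  { apply (continuous_plus (fun u : R * R => fst u * fst u) (fun u => snd u * snd u)).
    - apply (continuous_mult (fun u : R * R => fst u) (fun u => fst u));
        apply continuous_fst.
    - apply (continuous_mult (fun u : R * R => snd u) (fun u => snd u));
        apply continuous_snd. }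
  assert (hl : locally (x * x + y * y) (fun s => s < 1)) by (apply (open_lt 1); lra).
  generalize (hc _ hl); unfold filtermap; cbn [fst snd].
  apply filter_imp; intros [a b] h; apply unit_disk_sqr; cbn [fst snd] in h; lra.
Qed.

(** Continuity of the partial derivatives is what upgrades them to a total
    derivative, on which the chain rules for scalar functions rest. *)
Lemma C1_partials_filterdiff (f fx fy : C -> R) (x y : R) :
  C1_partials unit_disk f fx fy -> unit_disk (x, y) ->
  filterdiff (fun u : R * R => f (fst u, snd u)) (locally (x, y))
    (fun u : R * R => plus (scal (fst u) (fx (x, y))) (scal (snd u) (fy (x, y)))).
Proof.
  intros hf hz.
  apply (is_derive_filterdiff (fun a b => f (a, b)) x y (fun a b => fx (a, b))).
  - generalize (unit_disk_open _ hz); apply filter_imp; intros [a b] hab.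
    apply (hf _ hab).
  - apply (hf _ hz).
  - apply continuous_ext with (f := fx); [intros [a b]; reflexivity|apply (hf _ hz)].
Qed.

Lemma C1_partials_continuous (f fx fy : C -> R) (z : C) :
  C1_partials unit_disk f fx fy -> unit_disk z -> continuous f z.
Proof.
  destruct z as [x y]; intros hf hz.
  apply continuous_ext with (f := fun u : R * R => f (fst u, snd u)).
  { intros [a b]; reflexivity. }
  apply (filterdiff_continuous (K := R_AbsRing) (V := R_NormedModule)
    (U := prod_NormedModule R_AbsRing R_NormedModule R_NormedModule)).
  eexists; apply (C1_partials_filterdiff f fx fy); assumption.
Qed.

Lemma C1_partials_curve (f fx fy : C -> R) (x y : R -> R) (t dx dy : R) :
  C1_partials unit_disk f fx fy -> unit_disk (x t, y t) ->
  is_derive x t dx -> is_derive y t dy ->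
  is_derive (fun s => f (x s, y s)) t
    (fx (x t, y t) * dx + fy (x t, y t) * dy).
Proof.
  intros hf hz hx hy.
  eapply filterdiff_ext_lin.
  - apply (filterdiff_comp'_2 x y (fun a b => f (a, b)) t
             (fun h => scal h dx) (fun h => scal h dy)
             (fun a b => plus (scal a (fx (x t, y t))) (scal b (fy (x t, y t))))).
    + exact hx.
    + exact hy.
    + apply C1_partials_filterdiff; assumption.
  - intro h; unfold scal, plus; simpl; unfold mult; simpl; ring.
Qed.

(** * Holomorphic functions and their circle means *)

(** The two components are the Cauchy-Riemann equations: the real partial
    derivatives of [f] are [f'] and [i f']. *)
Definition holomorphic (f f' : C -> C) : Prop :=
  C1_partials unit_disk (fun z => fst (f z)) (fun z => fst (f' z)) (fun z => - snd (f' z)) /\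
  C1_partials unit_disk (fun z => snd (f z)) (fun z => snd (f' z)) (fun z => fst (f' z)).

Lemma C1_partials_plus (f fx fy g gx gy : C -> R) :
  C1_partials unit_disk f fx fy -> C1_partials unit_disk g gx gy ->
  C1_partials unit_disk (fun z => f z + g z) (fun z => fx z + gx z) (fun z => fy z + gy z).
Proof.
  intros hf hg z hz.
  destruct (hf z hz) as (a & b & c & d), (hg z hz) as (a' & b' & c' & d').
  refine (conj _ (conj _ (conj _ _))).
  - apply (is_derive_plus (K := R_AbsRing) (V := R_NormedModule)); assumption.
  - apply (is_derive_plus (K := R_AbsRing) (V := R_NormedModule)); assumption.
  - apply (continuous_plus (K := R_AbsRing) (V := R_NormedModule)); assumption.
  - apply (continuous_plus (K := R_AbsRing) (V := R_NormedModule)); assumption.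
Qed.

Lemma C1_partials_opp (f fx fy : C -> R) :
  C1_partials unit_disk f fx fy ->
  C1_partials unit_disk (fun z => - f z) (fun z => - fx z) (fun z => - fy z).
Proof.
  intros hf z hz.
  destruct (hf z hz) as (a & b & c & d).
  refine (conj _ (conj _ (conj _ _))).
  - apply (is_derive_opp (K := R_AbsRing) (V := R_NormedModule)); assumption.
  - apply (is_derive_opp (K := R_AbsRing) (V := R_NormedModule)); assumption.
  - apply (continuous_opp (K := R_AbsRing) (V := R_NormedModule)); assumption.
  - apply (continuous_opp (K := R_AbsRing) (V := R_NormedModule)); assumption.
Qed.

Lemma C1_partials_mult (f fx fy g gx gy : C -> R) :
  C1_partials unit_disk f fx fy -> C1_partials unit_disk g gx gy ->
  C1_partials unit_disk (fun z => f z * g z)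
    (fun z => fx z * g z + f z * gx z) (fun z => fy z * g z + f z * gy z).
Proof.
  intros hf hg z hz.
  pose proof (C1_partials_continuous _ _ _ z hf hz) as cf.
  pose proof (C1_partials_continuous _ _ _ z hg hz) as cg.
  destruct (hf z hz) as (a & b & c & d), (hg z hz) as (a' & b' & c' & d').
  destruct z as [x y].
  refine (conj _ (conj _ (conj _ _))).
  - apply (Derive.is_derive_mult (fun t => f (t, y)) (fun t => g (t, y))); assumption.
  - apply (Derive.is_derive_mult (fun t => f (x, t)) (fun t => g (x, t))); assumption.
  - apply (continuous_plus (K := R_AbsRing) (V := R_NormedModule));
      apply (continuous_mult (K := R_AbsRing)); assumption.
  - apply (continuous_plus (K := R_AbsRing) (V := R_NormedModule));
      apply (continuous_mult (K := R_AbsRing)); assumption.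
Qed.

Lemma C1_partials_ext (f fx fy g gx gy : C -> R) :
  (forall z, f z = g z) ->
  (forall z, unit_disk z -> fx z = gx z) -> (forall z, unit_disk z -> fy z = gy z) ->
  C1_partials unit_disk f fx fy -> C1_partials unit_disk g gx gy.
Proof.
  intros e ex ey h z hz; destruct (h z hz) as (a & b & c & d).
  pose proof (unit_disk_open z hz) as ho.
  refine (conj _ (conj _ (conj _ _))).
  - unfold is_derive_x in *; rewrite <- (ex z hz); revert a.
    apply (is_derive_ext (K := R_AbsRing) (V := R_NormedModule)); intros; apply e.
  - unfold is_derive_y in *; rewrite <- (ey z hz); revert b.
    apply (is_derive_ext (K := R_AbsRing) (V := R_NormedModule)); intros; apply e.
  - apply (continuous_ext_loc gx fx z); [|exact c].
    revert ho; apply filter_imp; exact ex.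
  - apply (continuous_ext_loc gy fy z); [|exact d].
    revert ho; apply filter_imp; exact ey.
Qed.

Lemma holomorphic_ext (f g f' g' : C -> C) :
  (forall z, f z = g z) -> (forall z, unit_disk z -> f' z = g' z) ->
  holomorphic f f' -> holomorphic g g'.
Proof.
  intros e e' [h1 h2]; split;
    [eapply C1_partials_ext; [| | |exact h1]|eapply C1_partials_ext; [| | |exact h2]];
    intros; cbv beta; rewrite ?e, ?e' by assumption; reflexivity.
Qed.

Lemma C1_partials_comp (f fx fy m mx my n nx ny : C -> R) :
  C1_partials unit_disk f fx fy ->
  C1_partials unit_disk m mx my -> C1_partials unit_disk n nx ny ->
  (forall z, unit_disk z -> unit_disk (m z, n z)) ->
  C1_partials unit_disk (fun z => f (m z, n z))
    (fun z => fx (m z, n z) * mx z + fy (m z, n z) * nx z)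
    (fun z => fx (m z, n z) * my z + fy (m z, n z) * ny z).
Proof.
  intros hf hm hn hD z hz.
  pose proof (C1_partials_continuous _ _ _ z hm hz) as cm.
  pose proof (C1_partials_continuous _ _ _ z hn hz) as cn.
  assert (cc : forall h : C -> R, continuous h (m z, n z) -> continuous (fun w => h (m w, n w)) z).
  { intros h ch.
    apply (continuous_comp_2 m n (fun a b => h (a, b)) z cm cn).
    apply continuous_ext with (f := h); [intros [? ?]; reflexivity|exact ch]. }
  pose proof (hD z hz) as hDz.
  destruct (hf _ hDz) as (_ & _ & cfx & cfy).
  destruct (hm z hz) as (a & b & c & d), (hn z hz) as (a' & b' & c' & d').
  destruct z as [x y].
  refine (conj _ (conj _ (conj _ _))).
  - apply (C1_partials_curve f fx fy (fun t => m (t, y)) (fun t => n (t, y)) x); assumption.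
  - apply (C1_partials_curve f fx fy (fun t => m (x, t)) (fun t => n (x, t)) y); assumption.
  - apply (continuous_plus (K := R_AbsRing) (V := R_NormedModule));
      apply (continuous_mult (K := R_AbsRing)); auto.
  - apply (continuous_plus (K := R_AbsRing) (V := R_NormedModule));
      apply (continuous_mult (K := R_AbsRing)); auto.
Qed.

Lemma holomorphic_mult (f f' g g' : C -> C) :
  holomorphic f f' -> holomorphic g g' ->
  holomorphic (fun z => f z * g z)%C (fun z => f' z * g z + f z * g' z)%C.
Proof.
  intros [f1 f2] [g1 g2]; split.
  - eapply C1_partials_ext;
      [| | |exact (C1_partials_plus _ _ _ _ _ _ (C1_partials_mult _ _ _ _ _ _ f1 g1)
                (C1_partials_opp _ _ _ (C1_partials_mult _ _ _ _ _ _ f2 g2)))];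
      intros; simpl; ring.
  - eapply C1_partials_ext;
      [| | |exact (C1_partials_plus _ _ _ _ _ _ (C1_partials_mult _ _ _ _ _ _ f1 g2)
                (C1_partials_mult _ _ _ _ _ _ f2 g1))];
      intros; simpl; ring.
Qed.

Lemma holomorphic_plus (f f' g g' : C -> C) :
  holomorphic f f' -> holomorphic g g' ->
  holomorphic (fun z => f z + g z)%C (fun z => f' z + g' z)%C.
Proof.
  intros [f1 f2] [g1 g2]; split.
  - eapply C1_partials_ext; [| | |exact (C1_partials_plus _ _ _ _ _ _ f1 g1)];
      intros; simpl; ring.
  - eapply C1_partials_ext; [| | |exact (C1_partials_plus _ _ _ _ _ _ f2 g2)];
      intros; simpl; ring.
Qed.

Lemma holomorphic_comp (f f' phi phi' : C -> C) :
  holomorphic f f' -> holomorphic phi phi' ->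
  (forall z, unit_disk z -> unit_disk (phi z)) ->
  holomorphic (fun z => f (phi z)) (fun z => f' (phi z) * phi' z)%C.
Proof.
  intros [f1 f2] [p1 p2] hD.
  assert (e : forall z, (fst (phi z), snd (phi z)) = phi z) by (intro; destruct (phi z); reflexivity).
  assert (hD' : forall z, unit_disk z -> unit_disk (fst (phi z), snd (phi z)))
    by (intros; rewrite e; auto).
  split.
  - eapply C1_partials_ext; [| | |exact (C1_partials_comp _ _ _ _ _ _ _ _ _ f1 p1 p2 hD')];
      intros; cbv beta; rewrite e; simpl; ring.
  - eapply C1_partials_ext; [| | |exact (C1_partials_comp _ _ _ _ _ _ _ _ _ f2 p1 p2 hD')];
      intros; cbv beta; rewrite e; simpl; ring.
Qed.

Lemma holomorphic_const (c : C) : holomorphic (fun _ => c) (fun _ => 0%C).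
Proof.
  split; intros z _; refine (conj _ (conj _ (conj _ _))); simpl; unfold is_derive_x, is_derive_y;
    try rewrite Ropp_0; try apply (is_derive_const (K := R_AbsRing) (V := R_NormedModule));
    apply continuous_const.
Qed.

Lemma holomorphic_id : holomorphic (fun z => z) (fun _ => 1%C).
Proof.
  split; intros z _; refine (conj _ (conj _ (conj _ _))); simpl; unfold is_derive_x, is_derive_y; simpl;
    try rewrite Ropp_0; try apply continuous_const;
    try apply (is_derive_const (K := R_AbsRing) (V := R_NormedModule));
    apply (is_derive_id (K := R_AbsRing)).
Qed.

Definition circle (r t : R) : C := (r * cos t, r * sin t).

Lemma circle_in_disk (r t : R) : -1 < r < 1 -> unit_disk (circle r t).
Proof.
  intro hr; apply unit_disk_sqr.
  pose proof (sin2_cos2 t) as h; unfold Rsqr in h.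
  replace ((r * cos t) ^ 2 + (r * sin t) ^ 2) with (r ^ 2 * (sin t * sin t + cos t * cos t)) by ring.
  rewrite h; nra.
Qed.

Lemma continuous_on_circle (f : C -> R) (r t : R) :
  continuous f (circle r t) -> continuous (fun s => f (circle r s)) t.
Proof.
  intro h.
  apply (continuous_comp_2 (fun s => r * cos s) (fun s => r * sin s) (fun a b => f (a, b))).
  - apply (ex_derive_continuous (K := R_AbsRing) (V := R_NormedModule)); auto_derive; trivial.
  - apply (ex_derive_continuous (K := R_AbsRing) (V := R_NormedModule)); auto_derive; trivial.
  - apply continuous_ext with (f := f); [intros [? ?]; reflexivity|exact h].
Qed.

Lemma ex_RInt_circle (g : R -> R) :
  (forall t, continuous g t) -> ex_RInt g 0 (2 * PI).
Proof. intro h; apply (ex_RInt_continuous (V := R_CompleteNormedModule)); intros; apply h. Qed.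

Lemma is_derive_circle_angle (f fx fy : C -> R) (r t : R) :
  C1_partials unit_disk f fx fy -> -1 < r < 1 ->
  is_derive (fun s => f (circle r s)) t
    (r * (fy (circle r t) * cos t - fx (circle r t) * sin t)).
Proof.
  intros hf hr.
  replace (r * (fy (circle r t) * cos t - fx (circle r t) * sin t)) with
    (fx (circle r t) * (r * - sin t) + fy (circle r t) * (r * cos t)) by ring.
  apply (C1_partials_curve f fx fy (fun s => r * cos s) (fun s => r * sin s) t).
  - exact hf.
  - apply circle_in_disk, hr.
  - auto_derive; [trivial|ring].
  - auto_derive; [trivial|ring].
Qed.

Lemma is_derive_circle_radius (f fx fy : C -> R) (r t : R) :
  C1_partials unit_disk f fx fy -> -1 < r < 1 ->
  is_derive (fun s => f (circle s t)) r
    (fx (circle r t) * cos t + fy (circle r t) * sin t).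
Proof.
  intros hf hr.
  apply (C1_partials_curve f fx fy (fun s => s * cos t) (fun s => s * sin t) r).
  - exact hf.
  - apply circle_in_disk, hr.
  - auto_derive; [trivial|ring].
  - auto_derive; [trivial|ring].
Qed.

Lemma locally_radius (r : R) : -1 < r < 1 -> locally r (fun s => -1 < s < 1).
Proof.
  intros [h1 h2].
  apply filter_and; [apply (open_gt (-1)); exact h1|apply (open_lt 1); exact h2].
Qed.

Lemma continuous_circle_both (f : C -> R) (r t : R) :
  continuous f (circle r t) ->
  continuous (fun u : R * R => f (circle (fst u) (snd u))) (r, t).
Proof.
  intro h.
  assert (cc : continuous (fun u : R * R => cos (snd u)) (r, t)).
  { apply (continuous_comp (fun u : R * R => snd u) cos).
    - apply continuous_snd.
    - apply continuous_cos. }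
  assert (cs : continuous (fun u : R * R => sin (snd u)) (r, t)).
  { apply (continuous_comp (fun u : R * R => snd u) sin).
    - apply continuous_snd.
    - apply continuous_sin. }
  apply (continuous_comp_2 (fun u : R * R => fst u * cos (snd u))
           (fun u : R * R => fst u * sin (snd u)) (fun a b => f (a, b))).
  - apply (continuous_mult (fun u : R * R => fst u)); [apply continuous_fst|exact cc].
  - apply (continuous_mult (fun u : R * R => fst u)); [apply continuous_fst|exact cs].
  - apply continuous_ext with (f := f); [intros [? ?]; reflexivity|exact h].
Qed.

Lemma is_derive_circle_mean (f fx fy : C -> R) (r : R) :
  C1_partials unit_disk f fx fy -> -1 < r < 1 ->
  is_derive (fun s => RInt (fun t => f (circle s t)) 0 (2 * PI)) r
    (RInt (fun t => fx (circle r t) * cos t + fy (circle r t) * sin t) 0 (2 * PI)).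
Proof.
  intros hf hr.
  rewrite (RInt_ext _ (fun t => Derive (fun s => f (circle s t)) r)).
  2:{ intros t _; symmetry; apply is_derive_unique, is_derive_circle_radius; assumption. }
  apply (is_derive_RInt_param (fun s t => f (circle s t))).
  - generalize (locally_radius r hr); apply filter_imp; intros s hs t _.
    eexists; apply (is_derive_circle_radius f fx fy); assumption.
  - intros t _.
    apply (continuity_2d_pt_ext_loc
             (fun s t => fx (circle s t) * cos t + fy (circle s t) * sin t)).
    { apply locally_2d_locally.
      assert (hp : locally (r, t) (fun u : R * R => -1 < fst u < 1)).
      { apply (continuous_fst r t (fun s => -1 < s < 1)), locally_radius, hr. }
      revert hp; apply filter_imp; intros [s t'] hs; symmetry.
      apply is_derive_unique, is_derive_circle_radius; assumption. }
    apply continuity_2d_pt_filterlim.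
    assert (hd := circle_in_disk r t hr).
    destruct (hf _ hd) as (_ & _ & cx & cy).
    apply (continuous_plus (K := R_AbsRing) (V := R_NormedModule)
             (fun u : R * R => fx (circle (fst u) (snd u)) * cos (snd u))
             (fun u : R * R => fy (circle (fst u) (snd u)) * sin (snd u))).
    + apply (continuous_mult (fun u : R * R => fx (circle (fst u) (snd u)))
               (fun u : R * R => cos (snd u))).
      * apply continuous_circle_both, cx.
      * apply (continuous_comp (fun u : R * R => snd u) cos);
          [apply continuous_snd|apply continuous_cos].
    + apply (continuous_mult (fun u : R * R => fy (circle (fst u) (snd u)))
               (fun u : R * R => sin (snd u))).
      * apply continuous_circle_both, cy.
      * apply (continuous_comp (fun u : R * R => snd u) sin);
          [apply continuous_snd|apply continuous_sin].
  - generalize (locally_radius r hr); apply filter_imp; intros s hs.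
    apply ex_RInt_circle; intro t; apply continuous_on_circle.
    apply (C1_partials_continuous f fx fy); [exact hf|apply circle_in_disk, hs].
Qed.

(** Differentiating under the integral, the derivative of the circle mean is the
    mean of the radial derivative, and the mean value theorem concludes. The
    hypothesis carries the factor [s] because [s] times the radial derivative is
    what occurs as an angular derivative. *)
Lemma circle_mean_const (f fx fy : C -> R) (r : R) :
  C1_partials unit_disk f fx fy ->
  (forall s, 0 < s < 1 ->
     is_RInt (fun t => s * (fx (circle s t) * cos t + fy (circle s t) * sin t)) 0 (2 * PI) 0) ->
  0 <= r < 1 ->
  is_RInt (fun t => f (circle r t)) 0 (2 * PI) (2 * PI * f 0%C).
Proof.
  intros hf h0 hr.
  set (I := fun s => RInt (fun t => f (circle s t)) 0 (2 * PI)).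
  assert (e0 : I 0 = 2 * PI * f 0%C).
  { unfold I; rewrite (RInt_ext _ (fun _ => f 0%C)).
    - rewrite RInt_const; unfold scal; simpl; unfold mult; simpl; ring.
    - intros t _; f_equal; unfold circle; rewrite !Rmult_0_l; reflexivity. }
  assert (er : I r = I 0).
  { destruct (Req_dec r 0) as [->|hr0]; [reflexivity|].
    destruct (MVT_gen I 0 r (fun _ => 0)) as [c [_ hc]].
    - rewrite Rmin_left, Rmax_right by lra; intros s hs.
      pose proof (is_derive_circle_mean f fx fy s hf ltac:(lra)) as hd.
      replace 0 with
        (RInt (fun t => fx (circle s t) * cos t + fy (circle s t) * sin t) 0 (2 * PI)).
      { exact hd. }
      apply (Rmult_eq_reg_l s); [|lra].
      rewrite Rmult_0_r; etransitivity;
        [|exact (is_RInt_unique _ _ _ _ (h0 s ltac:(lra)))].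
      symmetry; apply (RInt_scal (V := R_CompleteNormedModule)
        (fun t => fx (circle s t) * cos t + fy (circle s t) * sin t)).
      apply ex_RInt_circle; intro t.
      destruct (hf _ (circle_in_disk s t ltac:(lra))) as (_ & _ & cx & cy).
      apply (continuous_plus (K := R_AbsRing) (V := R_NormedModule));
        apply (continuous_mult (K := R_AbsRing)).
      + apply continuous_on_circle, cx.
      + apply continuous_cos.
      + apply continuous_on_circle, cy.
      + apply continuous_sin.
    - rewrite Rmin_left, Rmax_right by lra; intros s hs.
      apply continuity_pt_filterlim.
      apply (ex_derive_continuous (K := R_AbsRing) (V := R_NormedModule) I).
      eexists; apply (is_derive_circle_mean f fx fy); [exact hf|lra].
    - lra. }
  rewrite <- e0, <- er; apply (RInt_correct (V := R_CompleteNormedModule)), ex_RInt_circle.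
  intro t; apply continuous_on_circle.
  apply (C1_partials_continuous f fx fy); [exact hf|apply circle_in_disk; lra].
Qed.

Lemma circle_periodic (r : R) : circle r (2 * PI) = circle r 0.
Proof. unfold circle; rewrite cos_2PI, sin_2PI, cos_0, sin_0; reflexivity. Qed.

Lemma is_RInt_angle_derivative (f fx fy : C -> R) (r : R) :
  C1_partials unit_disk f fx fy -> -1 < r < 1 ->
  is_RInt (fun t => r * (fy (circle r t) * cos t - fx (circle r t) * sin t)) 0 (2 * PI) 0.
Proof.
  intros hf hr.
  replace 0 with (minus (f (circle r (2 * PI))) (f (circle r 0))) at 2.
  2:{ rewrite circle_periodic; apply (minus_eq_zero (G := R_AbelianGroup)). }
  apply (is_RInt_derive (V := R_CompleteNormedModule) (fun t => f (circle r t))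
     (fun t => r * (fy (circle r t) * cos t - fx (circle r t) * sin t))); intros t _.
  - apply is_derive_circle_angle; assumption.
  - destruct (hf _ (circle_in_disk r t hr)) as (_ & _ & cx & cy).
    apply (continuous_mult (K := R_AbsRing)); [apply continuous_const|].
    apply (continuous_minus (K := R_AbsRing) (V := R_NormedModule));
      apply (continuous_mult (K := R_AbsRing)).
    + apply continuous_on_circle, cy.
    + apply continuous_cos.
    + apply continuous_on_circle, cx.
    + apply continuous_sin.
Qed.

(** By Cauchy-Riemann, [s] times the radial derivative of the real part of [f] is
    the angular derivative of its imaginary part, and that has mean zero. *)
Lemma holomorphic_mean (f f' : C -> C) (r : R) :
  holomorphic f f' -> 0 <= r < 1 ->
  is_RInt (fun t => fst (f (circle r t))) 0 (2 * PI) (2 * PI * fst (f 0%C)).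
Proof.
  intros [h1 h2] hr.
  apply (circle_mean_const (fun z => fst (f z)) _ _ r h1); [|exact hr].
  intros s hs.
  generalize (is_RInt_angle_derivative _ _ _ s h2 ltac:(lra)).
  apply is_RInt_ext; intros t _; simpl; ring.
Qed.

(** * Fourier coefficients of harmonic functions *)

(** For harmonic [u] the function [g = u_x - i u_y], twice the Wirtinger
    derivative, is holomorphic: it turns statements on the Laplacian of [u] into
    statements on a holomorphic function. *)
Definition conjugate_gradient (u : C -> R) (g : C -> C) : Prop :=
  C1_partials unit_disk u (fun z => fst (g z)) (fun z => - snd (g z)).

(** The radial derivative times the radius is the real part of [z g(z)], whose
    circle means equal its value [0] at the origin. *)
Lemma harmonic_circle_mean (u : C -> R) (g g' : C -> C) (r : R) :
  conjugate_gradient u g -> holomorphic g g' -> 0 <= r < 1 ->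
  is_RInt (fun t => u (circle r t)) 0 (2 * PI) (2 * PI * u 0%C).
Proof.
  intros hu hg hr; apply (circle_mean_const u _ _ r hu); [|exact hr].
  intros s hs.
  pose proof (holomorphic_mean _ _ s (holomorphic_mult _ _ _ _ holomorphic_id hg) ltac:(lra)) as h.
  cbv beta in h; replace (2 * PI * fst (0 * g 0)%C) with 0 in h by (simpl; ring).
  revert h; apply is_RInt_ext; intros t _; simpl; ring.
Qed.

(** Integrating by parts against [S = b sin - c cos] replaces [u] by its angular
    derivative. What results is, up to the trigonometric identity, [r / 2] times
    the real part of [(b + i c) g - (b - i c) z^2 g / r^2]; the second term has
    mean zero because [z^2 g] vanishes at the origin. *)
Lemma harmonic_circle_first_coefficient (u : C -> R) (g g' : C -> C) (r b c : R) :
  conjugate_gradient u g -> holomorphic g g' -> 0 < r < 1 ->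
  is_RInt (fun t => u (circle r t) * (b * cos t + c * sin t)) 0 (2 * PI)
    (PI * r * (b * fst (g 0%C) - c * snd (g 0%C))).
Proof.
  intros hu hg hr.
  pose proof (holomorphic_mean _ _ r
    (holomorphic_mult _ _ _ _ (holomorphic_const (b, c)) hg) ltac:(lra)) as h1.
  pose proof (holomorphic_mean _ _ r
    (holomorphic_mult _ _ _ _ (holomorphic_const (b, - c))
      (holomorphic_mult _ _ _ _ holomorphic_id (holomorphic_mult _ _ _ _ holomorphic_id hg)))
    ltac:(lra)) as h2.
  set (S := fun t => b * sin t - c * cos t).
  assert (h3 : is_RInt (fun t =>
      r * (- snd (g (circle r t)) * cos t - fst (g (circle r t)) * sin t) * S t
      + u (circle r t) * (b * cos t + c * sin t)) 0 (2 * PI) 0).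
  { replace 0 with (minus (u (circle r (2 * PI)) * S (2 * PI)) (u (circle r 0) * S 0)) at 2.
    2:{ unfold S; rewrite circle_periodic, cos_2PI, sin_2PI, cos_0, sin_0.
        apply (minus_eq_zero (G := R_AbelianGroup)). }
    apply (is_RInt_derive (V := R_CompleteNormedModule) (fun t => u (circle r t) * S t)).
    - intros t _.
      apply (Derive.is_derive_mult (fun t => u (circle r t)) S).
      + apply (is_derive_circle_angle u _ _ r t hu); lra.
      + unfold S; auto_derive; [trivial|ring].
    - intros t _.
      assert (hd := circle_in_disk r t ltac:(lra)).
      destruct (hu _ hd) as (_ & _ & cx & cy).
      pose proof (C1_partials_continuous _ _ _ _ hu hd) as cu.
      assert (cS : continuous S t)
        by (apply (ex_derive_continuous (K := R_AbsRing) (V := R_NormedModule)); unfold S; auto_derive; trivial).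
      apply (continuous_plus (K := R_AbsRing) (V := R_NormedModule));
        apply (continuous_mult (K := R_AbsRing)).
      + apply (continuous_mult (K := R_AbsRing)); [apply continuous_const|].
        apply (continuous_minus (K := R_AbsRing) (V := R_NormedModule));
          apply (continuous_mult (K := R_AbsRing)).
        * apply (continuous_on_circle _ _ _ cy).
        * apply continuous_cos.
        * apply (continuous_on_circle _ _ _ cx).
        * apply continuous_sin.
      + exact cS.
      + apply (continuous_on_circle _ _ _ cu).
      + apply (ex_derive_continuous (K := R_AbsRing) (V := R_NormedModule)); auto_derive; trivial. }
  cbv beta in h1, h2.
  apply (is_RInt_scal _ _ _ (r / 2)) in h1.
  apply (is_RInt_scal _ _ _ (- (/ (2 * r)))) in h2.
  pose proof (is_RInt_plus _ _ _ _ _ _ h3 (is_RInt_plus _ _ _ _ _ _ h1 h2)) as h.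
  replace (PI * r * (b * fst (g 0%C) - c * snd (g 0%C))) with
    (plus 0 (plus (scal (r / 2) (2 * PI * fst ((b, c) * g 0)%C))
       (scal (- / (2 * r)) (2 * PI * fst ((b, (- c)%R) * (0 * (0 * g 0)))%C)))).
  2:{ unfold plus, scal; simpl; unfold mult; simpl; field; lra. }
  revert h; apply is_RInt_ext; intros t _.
  unfold plus, scal, S; simpl; unfold mult; simpl.
  set (p := fst (g (circle r t))); set (q := snd (g (circle r t))).
  (* Once the terms in [u] cancel, the identity is homogeneous of degree two in
     [cos t] and [sin t] except for the term of [h1], which is made so. *)
  pose proof (sin2_cos2 t) as e; unfold Rsqr in e.
  replace (r / 2 * (b * p - c * q)) with (r / 2 * (b * p - c * q) * (sin t * sin t + cos t * cos t))
    by (rewrite e; ring).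
  field; lra.
Qed.

Lemma conjugate_gradient_comp (u : C -> R) (g phi phi' : C -> C) :
  conjugate_gradient u g -> holomorphic phi phi' ->
  (forall z, unit_disk z -> unit_disk (phi z)) ->
  conjugate_gradient (fun z => u (phi z)) (fun z => g (phi z) * phi' z)%C.
Proof.
  intros hu [p1 p2] hD.
  assert (e : forall z, (fst (phi z), snd (phi z)) = phi z) by (intro; destruct (phi z); reflexivity).
  assert (hD' : forall z, unit_disk z -> unit_disk (fst (phi z), snd (phi z)))
    by (intros; rewrite e; auto).
  eapply C1_partials_ext; [| | |exact (C1_partials_comp _ _ _ _ _ _ _ _ _ hu p1 p2 hD')];
    intros; cbv beta; rewrite e; simpl; ring.
Qed.

Lemma C1_partials_inv (f fx fy : C -> R) :
  C1_partials unit_disk f fx fy -> (forall z, unit_disk z -> f z <> 0) ->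
  C1_partials unit_disk (fun z => / f z)
    (fun z => - fx z * (/ f z * / f z)) (fun z => - fy z * (/ f z * / f z)).
Proof.
  intros hf hn z hz.
  pose proof (C1_partials_continuous _ _ _ z hf hz) as cf.
  pose proof (hn z hz) as hnz.
  assert (ci : continuous (fun w => / f w) z).
  { apply (continuous_comp f Rinv z cf).
    apply (ex_derive_continuous (K := R_AbsRing) (V := R_NormedModule)); auto_derive; exact hnz. }
  destruct (hf z hz) as (a & b & c & d).
  destruct z as [x y].
  refine (conj _ (conj _ (conj _ _))).
  - replace (- fx (x, y) * (/ f (x, y) * / f (x, y))) with (- fx (x, y) / f (x, y) ^ 2) by (field; exact hnz).
    apply (is_derive_inv (fun t => f (t, y))); assumption.
  - replace (- fy (x, y) * (/ f (x, y) * / f (x, y))) with (- fy (x, y) / f (x, y) ^ 2) by (field; exact hnz).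
    apply (is_derive_inv (fun t => f (x, t))); assumption.
  - apply (continuous_mult (K := R_AbsRing)).
    + apply (continuous_opp (K := R_AbsRing) (V := R_NormedModule)), c.
    + apply (continuous_mult (K := R_AbsRing)); exact ci.
  - apply (continuous_mult (K := R_AbsRing)).
    + apply (continuous_opp (K := R_AbsRing) (V := R_NormedModule)), d.
    + apply (continuous_mult (K := R_AbsRing)); exact ci.
Qed.

Lemma holomorphic_inv (f f' : C -> C) :
  holomorphic f f' -> (forall z, unit_disk z -> fst (f z) ^ 2 + snd (f z) ^ 2 <> 0) ->
  holomorphic (fun z => / f z)%C (fun z => - f' z * (/ f z * / f z))%C.
Proof.
  intros [f1 f2] hn.
  pose proof (C1_partials_plus _ _ _ _ _ _ (C1_partials_mult _ _ _ _ _ _ f1 f1)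
     (C1_partials_mult _ _ _ _ _ _ f2 f2)) as hN.
  apply C1_partials_inv in hN.
  2:{ intros z hz h; apply (hn z hz); rewrite <- h; ring. }
  split.
  - eapply C1_partials_ext; [| | |exact (C1_partials_mult _ _ _ _ _ _ f1 hN)].
    + intro z; unfold Cinv, Rdiv; cbn [fst snd]; do 2 f_equal; ring.
    + intros z hz; specialize (hn z hz); simpl; field.
      replace (fst (f z) * fst (f z) + snd (f z) * snd (f z)) with (fst (f z) ^ 2 + snd (f z) ^ 2) by ring.
      auto.
    + intros z hz; specialize (hn z hz); simpl; field.
      replace (fst (f z) * fst (f z) + snd (f z) * snd (f z)) with (fst (f z) ^ 2 + snd (f z) ^ 2) by ring.
      auto.
  - eapply C1_partials_ext; [| | |exact (C1_partials_opp _ _ _ (C1_partials_mult _ _ _ _ _ _ f2 hN))].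
    + intro z; unfold Cinv, Rdiv; cbn [fst snd]; rewrite Ropp_mult_distr_l; do 2 f_equal; ring.
    + intros z hz; specialize (hn z hz); simpl; field.
      replace (fst (f z) * fst (f z) + snd (f z) * snd (f z)) with (fst (f z) ^ 2 + snd (f z) ^ 2) by ring.
      auto.
    + intros z hz; specialize (hn z hz); simpl; field.
      replace (fst (f z) * fst (f z) + snd (f z) * snd (f z)) with (fst (f z) ^ 2 + snd (f z) ^ 2) by ring.
      auto.
Qed.

(** * Moebius transformations of the disk *)

Definition moebius (z0 z : C) : C := ((z + z0) * / (1 + Cconj z0 * z))%C.

Lemma moebius_denominator_pos (z0 z : C) :
  unit_disk z0 -> unit_disk z ->
  fst (1 + Cconj z0 * z)%C ^ 2 + snd (1 + Cconj z0 * z)%C ^ 2 > 0.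
Proof.
  destruct z0 as [u v], z as [x y].
  rewrite !unit_disk_sqr; intros h0 h; simpl.
  set (s := u * x - - v * y); set (t := u * y + - v * x).
  assert (hst : s ^ 2 + t ^ 2 = (u ^ 2 + v ^ 2) * (x ^ 2 + y ^ 2)) by (unfold s, t; ring).
  pose proof (pow2_ge_0 u); pose proof (pow2_ge_0 v); pose proof (pow2_ge_0 x);
    pose proof (pow2_ge_0 y); pose proof (pow2_ge_0 t).
  assert (s ^ 2 < 1) by nra.
  assert (0 < 1 + s) by nra.
  assert (0 < (1 + s) * (1 + s)) by (apply Rmult_lt_0_compat; assumption).
  nra.
Qed.

(** With [N = |1 + conj z0 z|^2], one has
    [N - |z + z0|^2 = (1 - |z0|^2) (1 - |z|^2)]. *)
Lemma moebius_in_disk (z0 z : C) :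
  unit_disk z0 -> unit_disk z -> unit_disk (moebius z0 z).
Proof.
  intros h0 h; pose proof (moebius_denominator_pos z0 z h0 h) as hN.
  unfold moebius; revert hN.
  destruct z0 as [u v], z as [x y]; apply unit_disk_sqr in h0, h.
  simpl; set (a := 1 + (u * x - - v * y)); set (b := 0 + (u * y + - v * x)).
  intro hN; apply unit_disk_sqr; simpl; fold a b.
  match goal with |- ?l < 1 =>
    replace l with (((x + u) ^ 2 + (y + v) ^ 2) / (a * (a * 1) + b * (b * 1)))
      by (field; lra)
  end.
  apply (Rmult_lt_reg_r (a * (a * 1) + b * (b * 1))); [lra|].
  unfold Rdiv; rewrite Rmult_assoc, Rinv_l by lra.
  unfold a, b; nra.
Qed.

Lemma moebius_0 (z0 : C) : moebius z0 0%C = z0.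
Proof. unfold moebius; destruct z0 as [u v]; apply injective_projections; simpl; field. Qed.

(** The derivative is shown to be holomorphic as well because the conjugate
    gradient of [u o phi] is [(g o phi) phi'], and the circle means are applied to
    this product. *)
Lemma moebius_holomorphic (z0 : C) :
  unit_disk z0 ->
  exists phi' phi'' : C -> C,
    holomorphic (moebius z0) phi' /\ holomorphic phi' phi'' /\
    phi' 0%C = RtoC (1 - (fst z0 ^ 2 + snd z0 ^ 2)).
Proof.
  intro h0.
  pose proof (holomorphic_plus _ _ _ _ (holomorphic_const 1)
    (holomorphic_mult _ _ _ _ (holomorphic_const (Cconj z0)) holomorphic_id)) as hd.
  pose proof (holomorphic_inv _ _ hd) as hk.
  specialize (hk ltac:(intros z hz; pose proof (moebius_denominator_pos z0 z h0 hz); lra)).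
  assert (hz := holomorphic_plus _ _ _ _ holomorphic_id (holomorphic_const z0)).
  assert (hdd := holomorphic_plus _ _ _ _ (holomorphic_const 0)
    (holomorphic_plus _ _ _ _ (holomorphic_mult _ _ _ _ (holomorphic_const 0) holomorphic_id)
       (holomorphic_mult _ _ _ _ (holomorphic_const (Cconj z0)) (holomorphic_const 1)))).
  assert (hkk := holomorphic_mult _ _ _ _
     (holomorphic_mult _ _ _ _ (holomorphic_const (-1)) hdd) (holomorphic_mult _ _ _ _ hk hk)).
  eexists; eexists; split; [exact (holomorphic_mult _ _ _ _ hz hk)|split].
  - eapply holomorphic_ext; [| |exact (holomorphic_plus _ _ _ _
       (holomorphic_mult _ _ _ _ (holomorphic_plus _ _ _ _ (holomorphic_const 1) (holomorphic_const 0)) hk)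
       (holomorphic_mult _ _ _ _ hz hkk))].
    + intro z; cbv beta; ring.
    + intros z _; reflexivity.
  - destruct z0 as [u v]; apply injective_projections; simpl; field.
Qed.

(** * The inner product *)

Lemma inner_plus_r (H : RealHilbert) (x y z : H) :
  inner x (plus y z) = inner x y + inner x z.
Proof. rewrite inner_sym, inner_plus_l, !(inner_sym _ x); reflexivity. Qed.

Lemma inner_scal_r (H : RealHilbert) (a : R) (x y : H) :
  inner x (scal a y) = a * inner x y.
Proof. rewrite inner_sym, inner_scal_l, (inner_sym _ x); reflexivity. Qed.

Lemma inner_zero_l (H : RealHilbert) (x : H) : inner zero x = 0.
Proof.
  pose proof (inner_plus_l H zero zero x) as h.
  rewrite plus_zero_l in h; lra.
Qed.

Lemma inner_self_nonneg (H : RealHilbert) (x : H) : 0 <= inner x x.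
Proof. rewrite inner_self; apply pow2_ge_0. Qed.

Lemma cauchy_schwarz (H : RealHilbert) (x y : H) :
  Rabs (inner x y) <= norm x * norm y.
Proof.
  pose proof (norm_ge_0 x) as hx; pose proof (norm_ge_0 y) as hy.
  pose proof (inner_self_nonneg H (plus (scal (norm y ^ 2) x) (scal (- inner x y) y))) as h.
  rewrite !inner_plus_l, !inner_plus_r, !inner_scal_l, !inner_scal_r, (inner_sym _ y x),
    !inner_self in h.
  rewrite <- (Rabs_pos_eq (norm x * norm y)) by (apply Rmult_le_pos; assumption).
  apply Rsqr_le_abs_0; unfold Rsqr.
  destruct (Req_dec (norm y) 0) as [e|hne].
  - rewrite (norm_eq_zero y e), inner_sym, inner_zero_l; nra.
  - assert (0 < norm y ^ 2) by nra.
    nra.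
Qed.

Lemma is_linear_inner (H : RealHilbert) (A : H) :
  is_linear (K := R_AbsRing) (U := H) (V := R_NormedModule) (fun x : H => inner x A).
Proof.
  split.
  - intros x y; apply inner_plus_l.
  - intros k x; apply inner_scal_l.
  - exists (norm A + 1); split; [pose proof (norm_ge_0 A); lra|].
    intro x; pose proof (cauchy_schwarz H x A) as h.
    pose proof (norm_ge_0 x).
    apply Rle_trans with (1 := h); lra.
Qed.

Lemma is_derive_inner (H : RealHilbert) (A : H) (f : R -> H) (t : R) (l : H) :
  is_derive f t l -> is_derive (fun s => inner (f s) A) t (inner l A).
Proof.
  intro hf; eapply filterdiff_ext_lin.
  - apply (filterdiff_comp' f (fun x : H => inner x A) t (fun h => scal h l) (fun x : H => inner x A) hf).
    apply (filterdiff_linear (V := R_NormedModule)), is_linear_inner.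
  - intro h; cbv beta; rewrite inner_scal_l; reflexivity.
Qed.

Lemma C1_partials_inner (H : RealHilbert) (F Fx Fy : C -> H) (A : H) :
  C1_partials unit_disk F Fx Fy ->
  C1_partials unit_disk (fun z => inner (F z) A) (fun z => inner (Fx z) A)
    (fun z => inner (Fy z) A).
Proof.
  intros hF z hz; destruct (hF z hz) as (a & b & c & d).
  pose proof (is_linear_inner H A) as hl.
  refine (conj _ (conj _ (conj _ _))).
  - apply (is_derive_inner H A _ _ _ a).
  - apply (is_derive_inner H A _ _ _ b).
  - apply (continuous_comp Fx (fun x : H => inner x A) z c).
    apply (linear_cont (U := H) (V := R_NormedModule)), hl.
  - apply (continuous_comp Fy (fun x : H => inner x A) z d).
    apply (linear_cont (U := H) (V := R_NormedModule)), hl.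
Qed.

(** * Harmonic maps into a Hilbert space *)

Lemma C1_partials_mixed (f fx fy fxx fxy fyx fyy : C -> R) (z : C) :
  C1_partials unit_disk f fx fy -> C1_partials unit_disk fx fxx fxy ->
  C1_partials unit_disk fy fyx fyy -> unit_disk z -> fxy z = fyx z.
Proof.
  intros hf hx hy hz; destruct z as [x y].
  pose proof (unit_disk_open _ hz) as ho.
  assert (ho2 : locally_2d (fun u v => unit_disk (u, v)) x y).
  { apply locally_2d_locally; revert ho; apply filter_imp; intros [a b]; trivial. }
  assert (dx : forall u v, unit_disk (u, v) -> Derive (fun z => f (z, v)) u = fx (u, v))
    by (intros u v h; apply is_derive_unique, (hf _ h)).
  assert (dy : forall u v, unit_disk (u, v) -> Derive (fun z => f (u, z)) v = fy (u, v))
    by (intros u v h; apply is_derive_unique, (hf _ h)).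
  assert (dyx : forall u v, unit_disk (u, v) ->
            is_derive (fun z => Derive (fun t => f (z, t)) v) u (fyx (u, v))).
  { intros u v h; apply is_derive_ext_loc with (f := fun z => fy (z, v)).
    - assert (hl : continuous (fun z => (z, v) : R * R) u).
      { apply (continuous_comp_2 (fun z : R => z) (fun _ => v) (fun a b => (a, b) : R * R)).
        - apply continuous_id.
        - apply continuous_const.
        - apply continuous_ext with (f := fun p : R * R => p);
            [intros [? ?]; reflexivity|apply continuous_id]. }
      generalize (hl _ (unit_disk_open _ h)); unfold filtermap.
      apply filter_imp; intros s hs; symmetry; apply dy, hs.
    - apply (hy _ h). }
  assert (dxy : forall u v, unit_disk (u, v) ->
            is_derive (fun z => Derive (fun t => f (t, z)) u) v (fxy (u, v))).
  { intros u v h; apply is_derive_ext_loc with (f := fun z => fx (u, z)).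
    - assert (hl : continuous (fun z => (u, z) : R * R) v).
      { apply (continuous_comp_2 (fun _ => u) (fun z : R => z) (fun a b => (a, b) : R * R)).
        - apply continuous_const.
        - apply continuous_id.
        - apply continuous_ext with (f := fun p : R * R => p);
            [intros [? ?]; reflexivity|apply continuous_id]. }
      generalize (hl _ (unit_disk_open _ h)); unfold filtermap.
      apply filter_imp; intros s hs; symmetry; apply dx, hs.
    - apply (hx _ h). }
  rewrite <- (is_derive_unique _ _ _ (dxy x y hz)), <- (is_derive_unique _ _ _ (dyx x y hz)).
  symmetry; apply (Schwarz (fun a b => f (a, b))).
  - apply locally_2d_impl with (2 := ho2), locally_2d_forall.
    intros u v h; refine (conj _ (conj _ (conj _ _))).
    + eexists; apply (hf _ h).
    + eexists; apply (hf _ h).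
    + eexists; apply dyx, h.
    + eexists; apply dxy, h.
  - apply continuity_2d_pt_ext_loc with (f := fun u v => fyx (u, v)).
    + apply locally_2d_impl with (2 := ho2), locally_2d_forall.
      intros u v h; symmetry; apply is_derive_unique, dyx, h.
    + apply continuity_2d_pt_filterlim.
      refine (continuous_ext fyx (fun u : R * R => fyx (fst u, snd u)) (x, y) _ _);
        [intros [? ?]; reflexivity|apply (hy _ hz)].
  - apply continuity_2d_pt_ext_loc with (f := fun u v => fxy (u, v)).
    + apply locally_2d_impl with (2 := ho2), locally_2d_forall.
      intros u v h; symmetry; apply is_derive_unique, dxy, h.
    + apply continuity_2d_pt_filterlim.
      refine (continuous_ext fxy (fun u : R * R => fxy (fst u, snd u)) (x, y) _ _);
        [intros [? ?]; reflexivity|apply (hx _ hz)].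
Qed.

(** Harmonicity in the form in which it is used: each scalar component of the map
    has a holomorphic conjugate gradient. *)
Definition harmonic_components {H : RealHilbert} (F Fx Fy : C -> H) : Prop :=
  forall A : H, exists g' : C -> C,
    let g := fun z => (inner (Fx z) A, - inner (Fy z) A) : C in
    conjugate_gradient (fun z => inner (F z) A) g /\ holomorphic g g'.

(** The Cauchy-Riemann equations for [u_x - i u_y] are the Laplace equation
    and the symmetry of the mixed derivatives. *)
Lemma harmonic_conjugate_gradient (H : RealHilbert) (F : C -> H) :
  harmonic_on unit_disk F ->
  exists Fx Fy : C -> H,
    C1_partials unit_disk F Fx Fy /\ harmonic_components F Fx Fy.
Proof.
  intros (Fx & Fy & Fxx & Fxy & Fyx & Fyy & h & hx & hy & hL).
  exists Fx, Fy; split; [exact h|]; intro A.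
  pose proof (C1_partials_inner _ _ _ _ A h) as k.
  pose proof (C1_partials_inner _ _ _ _ A hx) as kx.
  pose proof (C1_partials_inner _ _ _ _ A hy) as ky.
  assert (kL : forall z, unit_disk z -> inner (Fxx z) A = - inner (Fyy z) A).
  { intros z hz; pose proof (hL z hz) as e.
    assert (inner (plus (Fxx z) (Fyy z)) A = 0).
    { rewrite e; apply inner_zero_l. }
    rewrite inner_plus_l in *; lra. }
  exists (fun z => (inner (Fxx z) A, - inner (Fyx z) A)); cbv zeta; split; [|split].
  - eapply C1_partials_ext; [| | |exact k]; intros; simpl; ring.
  - eapply C1_partials_ext; [| | |exact kx]; intros z; simpl; try reflexivity.
    intro hz; rewrite Ropp_involutive.
    apply (C1_partials_mixed _ _ _ _ _ _ _ z k kx ky hz).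
  - eapply C1_partials_ext; [| | |exact (C1_partials_opp _ _ _ ky)]; intros z; simpl; try reflexivity.
    intro hz; symmetry; apply kL, hz.
Qed.

(** Against a trigonometric polynomial of degree one, the circle mean of a
    harmonic map sees only its value and its differential at the centre. The
    Moebius transformation moves the centre to [z0], and [(v, w)] rotates the
    circle. *)
Lemma harmonic_circle_test (H : RealHilbert) (F Fx Fy : C -> H) (z0 : C) (A0 A1 A2 : H) (v w r : R) :
  harmonic_components F Fx Fy ->
  unit_disk z0 -> 0 < r < 1 ->
  is_RInt (fun t => inner (F (moebius z0 (circle r t)))
      (plus A0 (plus (scal (v * cos t + w * sin t) A1) (scal (- w * cos t + v * sin t) A2))))
    0 (2 * PI)
    (2 * PI * inner (F z0) A0 + PI * r * (1 - (fst z0 ^ 2 + snd z0 ^ 2)) *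
       (inner (plus (scal v (Fx z0)) (scal w (Fy z0))) A1
        + inner (plus (scal (- w) (Fx z0)) (scal v (Fy z0))) A2)).
Proof.
  intros hF hz0 hr.
  destruct (moebius_holomorphic z0 hz0) as (phi' & phi'' & hphi & hphi' & e').
  assert (hD : forall z, unit_disk z -> unit_disk (moebius z0 z))
    by (intros; apply moebius_in_disk; assumption).
  destruct (hF A0) as (g0' & k0 & j0), (hF A1) as (g1' & k1 & j1), (hF A2) as (g2' & k2 & j2).
  cbv zeta in *.
  pose proof (harmonic_circle_mean _ _ _ r (conjugate_gradient_comp _ _ _ _ k0 hphi hD)
    (holomorphic_mult _ _ _ _ (holomorphic_comp _ _ _ _ j0 hphi hD) hphi') ltac:(lra)) as i0.
  pose proof (harmonic_circle_first_coefficient _ _ _ r v w (conjugate_gradient_comp _ _ _ _ k1 hphi hD)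
    (holomorphic_mult _ _ _ _ (holomorphic_comp _ _ _ _ j1 hphi hD) hphi') ltac:(lra)) as i1.
  pose proof (harmonic_circle_first_coefficient _ _ _ r (- w) v (conjugate_gradient_comp _ _ _ _ k2 hphi hD)
    (holomorphic_mult _ _ _ _ (holomorphic_comp _ _ _ _ j2 hphi hD) hphi') ltac:(lra)) as i2.
  pose proof (is_RInt_plus _ _ _ _ _ _ i0 (is_RInt_plus _ _ _ _ _ _ i1 i2)) as i.
  cbv beta in i; rewrite !moebius_0, e' in i.
  match type of i with is_RInt _ _ _ ?l => match goal with |- is_RInt _ _ _ ?l' =>
    replace l' with l end end.
  - revert i; apply is_RInt_ext; intros t _.
    rewrite !inner_plus_r, !inner_scal_r; unfold plus; simpl; ring.
  - rewrite !inner_plus_l, !inner_scal_l; unfold plus; simpl; ring.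
Qed.

(** If the trigonometric polynomial is bounded in norm by a scalar one, the
    Cauchy-Schwarz inequality bounds the integrand of [harmonic_circle_test]
    by the latter, since the map has values in the unit ball. *)
Lemma harmonic_extremal_inequality (H : RealHilbert) (F Fx Fy : C -> H) (z0 : C)
    (A0 A1 A2 : H) (v w w0 w1 w2 : R) :
  harmonic_components F Fx Fy ->
  (forall z, unit_disk z -> unit_ball H (F z)) ->
  unit_disk z0 -> v ^ 2 + w ^ 2 = 1 ->
  (forall c s : R, c ^ 2 + s ^ 2 = 1 ->
     norm (plus A0 (plus (scal c A1) (scal s A2))) <= w0 + w1 * c + w2 * s) ->
  2 * inner (F z0) A0 + (1 - (fst z0 ^ 2 + snd z0 ^ 2)) *
       (inner (plus (scal v (Fx z0)) (scal w (Fy z0))) A1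
        + inner (plus (scal (- w) (Fx z0)) (scal v (Fy z0))) A2) <= 2 * w0.
Proof.
  intros hF hB hz0 hvw hP.
  set (M := (1 - (fst z0 ^ 2 + snd z0 ^ 2)) *
       (inner (plus (scal v (Fx z0)) (scal w (Fy z0))) A1
        + inner (plus (scal (- w) (Fx z0)) (scal v (Fy z0))) A2)).
  assert (hr : forall r, 0 < r < 1 -> 2 * inner (F z0) A0 + r * M <= 2 * w0).
  { intros r hr.
    pose proof (harmonic_circle_test H F Fx Fy z0 A0 A1 A2 v w r hF hz0 hr) as i.
    set (W := fun t => w0 * t + w1 * (v * sin t - w * cos t) + w2 * (- w * sin t - v * cos t)).
    assert (j : is_RInt (fun t => w0 + w1 * (v * cos t + w * sin t) + w2 * (- w * cos t + v * sin t))
              0 (2 * PI) (2 * PI * w0)).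
    { replace (2 * PI * w0) with (minus (W (2 * PI)) (W 0)).
      2:{ unfold W, minus, plus, opp; simpl; rewrite cos_2PI, sin_2PI, cos_0, sin_0; ring. }
      apply (is_RInt_derive (V := R_CompleteNormedModule)).
      - intros t _; unfold W; auto_derive; [trivial|ring].
      - intros t _; apply (ex_derive_continuous (K := R_AbsRing) (V := R_NormedModule));
          auto_derive; trivial. }
    pose proof PI_RGT_0 as hpi.
    pose proof (is_RInt_le _ _ 0 (2 * PI) _ _ ltac:(lra) i j) as hle.
    assert (hin : forall t, 0 < t < 2 * PI ->
      inner (F (moebius z0 (circle r t)))
      (plus A0 (plus (scal (v * cos t + w * sin t) A1) (scal (- w * cos t + v * sin t) A2)))
      <= w0 + w1 * (v * cos t + w * sin t) + w2 * (- w * cos t + v * sin t)).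
    { intros t _.
      assert (hcs : (v * cos t + w * sin t) ^ 2 + (- w * cos t + v * sin t) ^ 2 = 1).
      { pose proof (sin2_cos2 t) as e; unfold Rsqr in e.
        transitivity ((v ^ 2 + w ^ 2) * (sin t * sin t + cos t * cos t)); [ring|].
        rewrite hvw, e; ring. }
      specialize (hP _ _ hcs).
      apply Rle_trans with (2 := hP).
      apply Rle_trans with (1 := Rle_abs _), Rle_trans with (1 := cauchy_schwarz _ _ _).
      assert (hb : norm (F (moebius z0 (circle r t))) < 1).
      { apply hB, moebius_in_disk; [exact hz0|apply circle_in_disk; lra]. }
      rewrite <- (Rmult_1_l (norm (plus A0 _))) at 2.
      apply Rmult_le_compat_r; [apply norm_ge_0|lra]. }
    specialize (hle hin); fold M in hle; cbv beta in hle.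
    assert (hle' : PI * (2 * inner (F z0) A0 + r * M) <= PI * (2 * w0)).
    { unfold M in *; lra. }
    apply Rmult_le_reg_l in hle'; assumption. }
  (* The radius now tends to 1. *)
  fold M; apply Rnot_lt_le; intro hlt.
  destruct (Rle_or_lt M 0) as [hM|hM].
  - pose proof (hr (/ 2) ltac:(lra)); nra.
  - set (d := 2 * inner (F z0) A0 + M - 2 * w0) in *.
    pose proof (hr (/2) ltac:(lra)).
    assert (hd : 0 < d) by (unfold d; lra).
    set (s := Rmin (/ 2) (d / (2 * M))).
    assert (hs : 0 < s) by (apply Rmin_glb_lt; [lra|apply Rdiv_lt_0_compat; lra]).
    assert (hs1 : s <= / 2) by apply Rmin_l.
    assert (hs2 : s * M <= d / 2).
    { apply Rle_trans with (d / (2 * M) * M).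
      - apply Rmult_le_compat_r; [lra|apply Rmin_r].
      - right; field; lra. }
    pose proof (hr (1 - s) ltac:(lra)); unfold d in *; nra.
Qed.

(** * The Schwarz-Pick inequality at a point *)

(** The plane [q + span(X, Y)] cuts the ball in a disk with centre [e], orthogonal
    to the plane, and radius [c]; in it, [q = e + c a] with [|a| < 1]. The
    conformal parametrization [g(z) = e + c (z + a) / (1 + conj a z)] of that disk
    maps the unit circle into the unit sphere, and its product with
    [|1 + conj a z|^2] is on the circle the trigonometric polynomial
    [A0 + A1 cos + A2 sin] below, of norm [|1 + conj a z|^2]. Tested against it,
    the hypothesis gives [m |X| <= c (1 - |a|^2)], where [|X| <= |Y|] is used to
    replace [Y] by [X]. Finally, vectors [u] of the plane satisfy
    [CK_norm q u <= |u| / (c (1 - |a|^2))]. *)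
Lemma extremal_slice_bound (H : RealHilbert) (q X Y : H) (m : R) :
  norm q < 1 -> 0 < m -> inner X Y = 0 -> 0 < norm X -> norm X <= norm Y ->
  (forall (A0 A1 A2 : H) (w0 w1 w2 : R),
    (forall c s : R, c ^ 2 + s ^ 2 = 1 ->
     norm (plus A0 (plus (scal c A1) (scal s A2))) <= w0 + w1 * c + w2 * s) ->
    2 * inner q A0 + m * (inner X A1 + inner Y A2) <= 2 * w0) ->
  forall x y : R,
    CK_norm q (plus (scal x X) (scal y Y)) * (m * norm X)
      <= norm (plus (scal x X) (scal y Y)).
Proof.
  intros hq hm hXY hX hXYn hext x y.
  set (l := norm X) in *; set (L := norm Y) in *.
  assert (hl : 0 < l) by exact hX.
  set (f1 := scal (/ l) X); set (f2 := scal (/ L) Y).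
  assert (e11 : inner f1 f1 = 1).
  { unfold f1; rewrite inner_scal_l, inner_scal_r, inner_self; fold l; field; lra. }
  assert (e22 : inner f2 f2 = 1).
  { unfold f2; rewrite inner_scal_l, inner_scal_r, inner_self; fold L; field; lra. }
  assert (e12 : inner f1 f2 = 0).
  { unfold f1, f2; rewrite inner_scal_l, inner_scal_r, hXY; ring. }
  assert (e21 : inner f2 f1 = 0) by (rewrite inner_sym; exact e12).
  assert (hX1 : forall A, inner X A = l * inner f1 A).
  { intro A; unfold f1; rewrite inner_scal_l; field; lra. }
  assert (hY2 : forall A, inner Y A = L * inner f2 A).
  { intro A; unfold f2; rewrite inner_scal_l; field; lra. }
  set (Q := inner q q).
  set (b1 := inner q f1); set (b2 := inner q f2).
  set (e := plus q (plus (scal (- b1) f1) (scal (- b2) f2))).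
  assert (ef1 : inner e f1 = 0).
  { unfold e; rewrite !inner_plus_l, !inner_scal_l, e11, e21; fold b1; ring. }
  assert (ef2 : inner e f2 = 0).
  { unfold e; rewrite !inner_plus_l, !inner_scal_l, e12, e22; fold b2; ring. }
  assert (f1e : inner f1 e = 0) by (rewrite inner_sym; exact ef1).
  assert (f2e : inner f2 e = 0) by (rewrite inner_sym; exact ef2).
  assert (qe : inner q e = Q - b1 ^ 2 - b2 ^ 2).
  { unfold e; rewrite !inner_plus_r, !inner_scal_r; fold Q b1 b2; ring. }
  assert (ee : inner e e = Q - b1 ^ 2 - b2 ^ 2).
  { unfold e at 1; rewrite !inner_plus_l, !inner_scal_l, f1e, f2e, qe; ring. }
  assert (hQ : Q < 1).
  { unfold Q; rewrite inner_self; pose proof (norm_ge_0 q); nra. }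
  assert (hE : 0 <= Q - b1 ^ 2 - b2 ^ 2) by (rewrite <- ee; apply inner_self_nonneg).
  set (c := sqrt (1 - (Q - b1 ^ 2 - b2 ^ 2))).
  assert (hcc : c * c = 1 - (Q - b1 ^ 2 - b2 ^ 2)).
  { apply sqrt_sqrt; pose proof (pow2_ge_0 b1); pose proof (pow2_ge_0 b2); lra. }
  assert (hc : 0 < c).
  { apply sqrt_lt_R0; pose proof (pow2_ge_0 b1); pose proof (pow2_ge_0 b2); lra. }
  set (a1 := b1 / c); set (a2 := b2 / c).
  assert (hb1 : b1 = c * a1) by (unfold a1; field; lra).
  assert (hb2 : b2 = c * a2) by (unfold a2; field; lra).
  assert (hQc : 1 - Q = c * c * (1 - (a1 ^ 2 + a2 ^ 2))).
  { transitivity (c * c - (c * a1) ^ 2 - (c * a2) ^ 2); [|ring].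
    rewrite <- hb1, <- hb2, hcc; ring. }
  assert (ha : a1 ^ 2 + a2 ^ 2 < 1).
  { assert (0 < c * c) by nra; nra. }
  assert (hmain : m * l <= c * (1 - (a1 ^ 2 + a2 ^ 2))).
  { pose (A0 := plus (scal (1 + (a1 ^ 2 + a2 ^ 2)) e)
                  (plus (scal (2 * c * a1) f1) (scal (2 * c * a2) f2))).
    pose (A1 := plus (scal (2 * a1) e)
                  (plus (scal (c * (1 + a1 ^ 2 - a2 ^ 2)) f1) (scal (c * (2 * a1 * a2)) f2))).
    pose (A2 := plus (scal (2 * a2) e)
                  (plus (scal (c * (2 * a1 * a2)) f1) (scal (c * (1 - a1 ^ 2 + a2 ^ 2)) f2))).
    pose proof (hext A0 A1 A2 (1 + (a1 ^ 2 + a2 ^ 2)) (2 * a1) (2 * a2)) as h.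
    assert (hP : forall C S : R, C ^ 2 + S ^ 2 = 1 ->
      norm (plus A0 (plus (scal C A1) (scal S A2)))
        <= 1 + (a1 ^ 2 + a2 ^ 2) + 2 * a1 * C + 2 * a2 * S).
    { intros C S hCS.
      (* This bound is |1 + conj a z|^2 at z = C + i S. *)
      assert (hw : 0 <= 1 + (a1 ^ 2 + a2 ^ 2) + 2 * a1 * C + 2 * a2 * S).
      { pose proof (pow2_ge_0 (a1 + C)); pose proof (pow2_ge_0 (a2 + S)); lra. }
      apply Rsqr_incr_0_var; [|exact hw]; unfold Rsqr.
      right; transitivity (norm (plus A0 (plus (scal C A1) (scal S A2))) ^ 2); [ring|].
      rewrite <- inner_self; unfold A0, A1, A2.
      repeat rewrite ?inner_plus_l, ?inner_plus_r, ?inner_scal_l, ?inner_scal_r.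
      rewrite ee, e11, e22, e12, e21, ef1, ef2, f1e, f2e.
      replace (Q - b1 ^ 2 - b2 ^ 2) with (1 - c * c) by lra.
      assert (hS : S * S = 1 - C * C) by lra.
      ring [hS]. }
    specialize (h hP).
    rewrite hX1, hY2 in h; unfold A0, A1, A2 in h.
    repeat rewrite ?inner_plus_r, ?inner_scal_r in h.
    rewrite e11, e22, e12, e21, f1e, f2e, qe in h; fold b1 b2 in h.
    replace (Q - b1 ^ 2 - b2 ^ 2) with (1 - c * c) in h by lra.
    rewrite hb1, hb2 in h.
    assert (h2 : c * (m * (l * (1 + a1 ^ 2 - a2 ^ 2) + L * (1 - a1 ^ 2 + a2 ^ 2)))
                 <= c * (2 * (c * (1 - (a1 ^ 2 + a2 ^ 2))))) by lra.
    apply Rmult_le_reg_l in h2; [|exact hc].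
    assert (h3 : 2 * l <= l * (1 + a1 ^ 2 - a2 ^ 2) + L * (1 - a1 ^ 2 + a2 ^ 2)).
    { assert (0 <= (L - l) * (1 - a1 ^ 2 + a2 ^ 2)); [|lra].
      pose proof (pow2_ge_0 a1); pose proof (pow2_ge_0 a2).
      apply Rmult_le_pos; lra. }
    apply (Rmult_le_compat_l m) in h3; lra. }
  set (u := plus (scal x X) (scal y Y)).
  assert (hu : norm u ^ 2 = (x * l) ^ 2 + (y * L) ^ 2).
  { rewrite <- inner_self; unfold u.
    rewrite !inner_plus_l, !inner_plus_r, !inner_scal_l, !inner_scal_r, (inner_sym _ Y X), hXY,
      !inner_self; fold l L; ring. }
  assert (hqu : inner q u = c * (a1 * (x * l) + a2 * (y * L))).
  { unfold u; rewrite inner_plus_r, !inner_scal_r, !(inner_sym _ q), hX1, hY2,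
      !(inner_sym _ _ q); fold b1 b2; rewrite hb1, hb2; ring. }
  assert (hCK : CK_norm q u <= c * norm u / (1 - Q)).
  { unfold CK_norm; rewrite <- (inner_self _ q); fold Q.
    unfold Rdiv; apply Rmult_le_compat_r; [apply Rlt_le, Rinv_0_lt_compat; lra|].
    rewrite <- (sqrt_pow2 (c * norm u)).
    2:{ apply Rmult_le_pos; [lra|apply norm_ge_0]. }
    apply sqrt_le_1_alt.
    rewrite hqu, hQc, Rpow_mult_distr, (Rpow_mult_distr c (norm u)), hu.
    pose proof (pow2_ge_0 (c * (a1 * (y * L) - a2 * (x * l)))); lra. }
  apply Rle_trans with (c * norm u / (1 - Q) * (m * l)).
  { apply Rmult_le_compat_r; [|exact hCK]; apply Rmult_le_pos; lra. }
  apply Rle_trans with (c * norm u / (1 - Q) * (c * (1 - (a1 ^ 2 + a2 ^ 2)))).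
  { apply Rmult_le_compat_l; [|exact hmain].
    apply Rmult_le_pos; [apply Rmult_le_pos; [lra|apply norm_ge_0]|].
    apply Rlt_le, Rinv_0_lt_compat; lra. }
  rewrite hQc; right; field; split; [nra|lra].
Qed.

(** * Differential and principal directions *)

Lemma norm_scal_hilbert (H : RealHilbert) (k : R) (x : H) :
  0 <= k -> norm (scal k x) = k * norm x.
Proof.
  intro hk; pose proof (norm_ge_0 x).
  apply Rsqr_inj; [apply norm_ge_0|apply Rmult_le_pos; assumption|].
  unfold Rsqr; transitivity (norm (scal k x) ^ 2); [ring|].
  rewrite <- inner_self, inner_scal_l, inner_scal_r, inner_self; ring.
Qed.

(** Uniqueness of derivatives is a scalar fact, tested on all components. *)
Lemma is_derive_hilbert_unique (H : RealHilbert) (f : R -> H) (t : R) (l1 l2 : H) :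
  is_derive f t l1 -> is_derive f t l2 -> l1 = l2.
Proof.
  intros h1 h2.
  assert (e : forall A, inner l1 A = inner l2 A).
  { intro A.
    rewrite <- (is_derive_unique _ _ _ (is_derive_inner H A f t l1 h1)).
    apply is_derive_unique, is_derive_inner, h2. }
  assert (e0 : inner (plus l1 (opp l2)) (plus l1 (opp l2)) = 0).
  { assert (eo : forall A, inner (opp l2) A = - inner l2 A).
    { intro A; pose proof (inner_plus_l H l2 (opp l2) A) as h.
      assert (eo : plus l2 (opp l2) = zero) by exact (plus_opp_r (G := H) l2).
      rewrite eo, inner_zero_l in h; lra. }
    rewrite inner_plus_l, eo, e; ring. }
  rewrite inner_self in e0.
  assert (e1 : norm (plus l1 (opp l2)) = 0) by nra.
  apply norm_eq_zero in e1.
  apply (plus_reg_r (G := H) (opp l2)).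
  transitivity (zero : H); [exact e1|symmetry; exact (plus_opp_r (G := H) l2)].
Qed.

Definition differential {H : RealHilbert} (Fx Fy : C -> H) (z v : C) : H :=
  plus (scal (fst v) (Fx z)) (scal (snd v) (Fy z)).

Lemma differential_unique (H : RealHilbert) (F Fx Fy : C -> H) (z : C) (dF : C -> H) :
  @filterdiff R_AbsRing C_R_NormedModule H F (locally z) dF ->
  is_derive_x F z (Fx z) -> is_derive_y F z (Fy z) ->
  forall v, dF v = differential Fx Fy z v.
Proof.
  intros hF hx hy [a b]; destruct z as [x y].
  assert (hlin : is_linear (U := C_R_NormedModule) dF) by apply hF.
  assert (hF' : filterdiff (fun u : prod_NormedModule R_AbsRing R_NormedModule R_NormedModule => F (fst u, snd u))
            (locally (x, y)) (fun u => dF (fst u, snd u))).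
  { apply (filterdiff_ext (K := R_AbsRing) (U := C_R_NormedModule) F); [intros [? ?]; reflexivity|].
    apply (filterdiff_ext_lin (K := R_AbsRing) (U := C_R_NormedModule) F dF); [exact hF|].
    intros [? ?]; reflexivity. }
  assert (ex : dF (1, 0) = Fx (x, y)).
  { apply (is_derive_hilbert_unique H (fun t => F (t, y)) x); [|exact hx].
    eapply filterdiff_ext_lin.
    - apply (filterdiff_comp'_2 (fun t : R => t) (fun _ : R => y) (fun a b => F (a, b)) x
               (fun h => h) (fun _ => zero) (fun a b => dF (a, b))).
      + apply filterdiff_id.
      + apply filterdiff_const; typeclasses eauto.
      + exact hF'.
    - intro h; cbv beta.
      rewrite <- (linear_scal (U := C_R_NormedModule) dF hlin); f_equal.
      apply injective_projections; symmetry; first [exact (Rmult_1_r h)|exact (Rmult_0_r h)]. }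
  assert (ey : dF (0, 1) = Fy (x, y)).
  { apply (is_derive_hilbert_unique H (fun t => F (x, t)) y); [|exact hy].
    eapply filterdiff_ext_lin.
    - apply (filterdiff_comp'_2 (fun _ : R => x) (fun t : R => t) (fun a b => F (a, b)) y
               (fun _ => zero) (fun h => h) (fun a b => dF (a, b))).
      + apply filterdiff_const; typeclasses eauto.
      + apply filterdiff_id.
      + exact hF'.
    - intro h; cbv beta.
      rewrite <- (linear_scal (U := C_R_NormedModule) dF hlin); f_equal.
      apply injective_projections; symmetry; first [exact (Rmult_1_r h)|exact (Rmult_0_r h)]. }
  unfold differential; cbn [fst snd]; rewrite <- ex, <- ey.
  rewrite <- !(linear_scal (U := C_R_NormedModule) dF hlin),
      <- (linear_plus (U := C_R_NormedModule) dF hlin); f_equal.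
  change ((a, b) = (a * 1 + b * 0, a * 0 + b * 1)); f_equal; ring.
Qed.

Lemma Cmod_sqr (z : C) : Cmod z ^ 2 = fst z ^ 2 + snd z ^ 2.
Proof.
  unfold Cmod; rewrite <- Rsqr_pow2; apply Rsqr_sqrt.
  pose proof (pow2_ge_0 (fst z)); pose proof (pow2_ge_0 (snd z)); lra.
Qed.

(** A direction [(v, w)] of least stretching and its rotation by a right angle
    have orthogonal images: otherwise turning the direction slightly would lower
    the stretching. In the proof, [hquad] bounds an affine function of [s] from
    below, so its slope vanishes. *)
Lemma quasiconformal_frame (H : RealHilbert) (K : R) (F Fx Fy : C -> H) (z : C) :
  quasiconformal_at K F z -> is_derive_x F z (Fx z) -> is_derive_y F z (Fy z) ->
  @filterdiff R_AbsRing C_R_NormedModule H F (locally z) (differential Fx Fy z) /\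
  exists v w : R,
    let X := differential Fx Fy z (v, w) in
    let Y := differential Fx Fy z (- w, v) in
    v ^ 2 + w ^ 2 = 1 /\ inner X Y = 0 /\ 0 < norm X /\ norm X <= norm Y /\
    (forall u : C, norm (differential Fx Fy z u) <= K * norm X * Cmod u) /\
    (forall u : C, differential Fx Fy z u
       = plus (scal (fst u * v + snd u * w) X) (scal (- fst u * w + snd u * v) Y)).
Proof.
  intros (dF & l & L & hdF & [[u0 [hu0 el]] hmin] & [_ hmax] & hl & hlL & hLK) hx hy.
  pose proof (differential_unique H F Fx Fy z dF hdF hx hy) as e.
  split.
  { apply (filterdiff_ext_lin (K := R_AbsRing) (U := C_R_NormedModule) F dF); [exact hdF|exact e]. }
  assert (hlin : is_linear (U := C_R_NormedModule) dF) by apply hdF.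
  destruct u0 as [v w]; exists v, w; cbv zeta; rewrite <- !e.
  set (X := dF (v, w)) in *; set (Y := dF (- w, v)) in *.
  assert (hvw : v ^ 2 + w ^ 2 = 1).
  { pose proof (Cmod_sqr (v, w)) as h; rewrite hu0 in h; simpl in h; lra. }
  assert (hdec : forall a b, dF (a, b) = plus (scal (a * v + b * w) X) (scal (- a * w + b * v) Y)).
  { intros a b; unfold X, Y.
    rewrite <- !(linear_scal (U := C_R_NormedModule) dF hlin),
      <- (linear_plus (U := C_R_NormedModule) dF hlin); f_equal.
    change ((a, b) = ((a * v + b * w) * v + (- a * w + b * v) * - w,
                      (a * v + b * w) * w + (- a * w + b * v) * v)); f_equal.
    - transitivity (a * (v ^ 2 + w ^ 2)); [rewrite hvw|]; ring.
    - transitivity (b * (v ^ 2 + w ^ 2)); [rewrite hvw|]; ring. }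
  assert (hunit : forall u : C, 0 < Cmod u ->
            stretches dF (/ Cmod u * norm (dF u))).
  { intros u hu.
    exists (scal (V := C_R_NormedModule) (/ Cmod u) u : C); split.
    - assert (h2 : Cmod (scal (V := C_R_NormedModule) (/ Cmod u) u : C) ^ 2 = 1).
      { rewrite Cmod_sqr.
        change ((/ Cmod u * fst u) ^ 2 + (/ Cmod u * snd u) ^ 2 = 1).
        transitivity (/ Cmod u ^ 2 * (fst u ^ 2 + snd u ^ 2)); [field; lra|].
        rewrite <- Cmod_sqr; field; lra. }
      pose proof (Cmod_ge_0 (scal (V := C_R_NormedModule) (/ Cmod u) u : C)); nra.
    - rewrite (linear_scal (U := C_R_NormedModule) dF hlin), norm_scal_hilbert; [reflexivity|].
      apply Rlt_le, Rinv_0_lt_compat, hu. }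
  assert (hlow : forall u : C, l * Cmod u <= norm (dF u)).
  { intro u; destruct (Rle_lt_or_eq_dec 0 (Cmod u) (Cmod_ge_0 u)) as [hu|hu].
    - pose proof (hmin _ (hunit u hu)) as h.
      apply (Rmult_le_compat_r (Cmod u)) in h; [|lra].
      replace (/ Cmod u * norm (dF u) * Cmod u) with (norm (dF u)) in h by (field; lra).
      exact h.
    - rewrite <- hu, Rmult_0_r; apply norm_ge_0. }
  assert (hupp : forall u : C, norm (dF u) <= L * Cmod u).
  { intro u; destruct (Rle_lt_or_eq_dec 0 (Cmod u) (Cmod_ge_0 u)) as [hu|hu].
    - pose proof (hmax _ (hunit u hu)) as h.
      apply (Rmult_le_compat_r (Cmod u)) in h; [|lra].
      replace (/ Cmod u * norm (dF u) * Cmod u) with (norm (dF u)) in h by (field; lra).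
      exact h.
    - symmetry in hu; apply Cmod_eq_0 in hu; subst u.
      replace (dF (RtoC 0)) with (scal 0 (dF (RtoC 0))).
      + rewrite norm_scal_hilbert, Cmod_0; lra.
      + rewrite <- (linear_scal (U := C_R_NormedModule) dF hlin); f_equal.
        change ((0 * 0, 0 * 0) = (0, 0)); f_equal; ring. }
  assert (hY : norm X <= norm Y).
  { rewrite <- el; pose proof (hlow (- w, v)) as h; fold Y in h.
    assert (hc : Cmod (- w, v) = 1).
    { pose proof (Cmod_sqr (- w, v)) as h1; simpl in h1.
      pose proof (Cmod_ge_0 (- w, v)); nra. }
    rewrite hc in h; lra. }
  assert (hquad : forall s : R, 0 <= 2 * s * inner X Y + (norm Y ^ 2 - norm X ^ 2)).
  { intro s.
    set (u := (s * v - w, s * w + v) : C).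
    assert (eu : dF u = plus (scal s X) Y).
    { unfold u, X, Y; rewrite <- !(linear_scal (U := C_R_NormedModule) dF hlin),
      <- (linear_plus (U := C_R_NormedModule) dF hlin).
      reflexivity. }
    assert (cu : Cmod u ^ 2 = s ^ 2 + 1).
    { rewrite Cmod_sqr; unfold u; simpl.
      transitivity (s ^ 2 * (v ^ 2 + w ^ 2) + (v ^ 2 + w ^ 2)); [ring|rewrite hvw; ring]. }
    pose proof (hlow u) as h; pose proof (Cmod_ge_0 u).
    assert (h2 : (l * Cmod u) ^ 2 <= norm (dF u) ^ 2).
    { apply pow_incr; split; [nra|exact h]. }
    rewrite Rpow_mult_distr, cu, eu, <- (inner_self _ (plus (scal s X) Y)) in h2.
    rewrite !inner_plus_l, !inner_plus_r, !inner_scal_l, !inner_scal_r, !inner_self,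
      (inner_sym _ Y X), <- el in h2.
    rewrite <- el; lra. }
  refine (conj hvw (conj _ (conj _ (conj hY (conj _ _))))).
  - destruct (Req_dec (inner X Y) 0) as [h0|h0]; [exact h0|exfalso].
    pose proof (hquad (- (norm Y ^ 2 - norm X ^ 2 + 1) / (2 * inner X Y))) as h.
    replace (2 * (- (norm Y ^ 2 - norm X ^ 2 + 1) / (2 * inner X Y)) * inner X Y) with
      (- (norm Y ^ 2 - norm X ^ 2 + 1)) in h by (field; exact h0).
    lra.
  - rewrite <- el; exact hl.
  - intro u; rewrite <- e, <- el.
    apply Rle_trans with (1 := hupp u), Rmult_le_compat_r; [apply Cmod_ge_0|exact hLK].
  - intros [a b]; rewrite <- e; apply hdec.
Qed.

(** With [m = 1 - |z|^2] and [X] the image of the least stretched direction, the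
    slice bound gives [CK_norm (F z) (dF u) * (m |X|) <= |dF u|], while
    quasiconformality gives [|dF u| <= K |X| |u|]. The factor [|X| > 0] cancels. *)
Lemma klein_poincare_pointwise (H : RealHilbert) (K : R) (F Fx Fy : C -> H) (z u : C) :
  0 <= K ->
  harmonic_components F Fx Fy ->
  C1_partials unit_disk F Fx Fy ->
  (forall z, unit_disk z -> unit_ball H (F z)) ->
  unit_disk z -> quasiconformal_at K F z ->
  CK_norm (F z) (differential Fx Fy z u) <= K * poincare_norm z u.
Proof.
  intros hK hF hC1 hB hz hqc.
  destruct (hC1 z hz) as (hx & hy & _).
  destruct (quasiconformal_frame H K F Fx Fy z hqc hx hy)
    as (_ & v & w & hvw & hXY & hX & hXYn & hLip & hdec).
  cbv zeta in *.
  set (m := 1 - (fst z ^ 2 + snd z ^ 2)).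
  assert (hm : 0 < m).
  { destruct z as [x y]; apply unit_disk_sqr in hz; unfold m; simpl in *; lra. }
  pose proof (extremal_slice_bound H (F z) _ _ m (hB z hz) hm hXY hX hXYn
    (fun A0 A1 A2 w0 w1 w2 hP =>
       harmonic_extremal_inequality H F Fx Fy z A0 A1 A2 v w w0 w1 w2 hF hB hz hvw hP)
    (fst u * v + snd u * w) (- fst u * w + snd u * v)) as h.
  rewrite <- hdec in h.
  pose proof (hLip u) as h2.
  unfold poincare_norm; rewrite Cmod_sqr; fold m.
  set (X := norm (differential Fx Fy z (v, w))) in *.
  apply (Rmult_le_reg_r (m * X)); [apply Rmult_lt_0_compat; assumption|].
  apply Rle_trans with (1 := h), Rle_trans with (1 := h2).
  right; field; lra.
Qed.

(** * Images of curves *)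

Lemma within_segment_proper (a b t : R) :
  a <= t <= b -> ProperFilter' (within_segment a b t).
Proof.
  intro ht; split.
  - intro h; exact (locally_singleton t _ h ht).
  - unfold within_segment; apply within_filter, locally_filter.
Qed.

(** A derivative along a filter is required at each limit of that filter; being
    proper, the image filter has no limit but [x]. *)
Lemma filterdiff_along {U V : NormedModule R_AbsRing} (f : U -> V) (l : U -> V) (x : U)
    (gamma : R -> U) (G : (R -> Prop) -> Prop) :
  ProperFilter' G -> filterdiff f (locally x) l ->
  filterlim gamma G (locally x) -> filterdiff f (filtermap gamma G) l.
Proof.
  intros hG [hl hf] hg; split; [exact hl|].
  assert (hGf : Filter G) by apply hG.
  intros y hy.
  assert (e : y = x).
  { assert (hP : ProperFilter' (filtermap gamma G)).
    { split; [apply hG|apply filtermap_filter, hGf]. }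
    exact (is_filter_lim_unique y x hy hg). }
  subst y; intro eps; apply hg.
  apply (hf x (fun P hP => hP) eps).
Qed.

(** Retraction of the line onto [[a, b]]: composing with it turns one-sided
    continuity on the segment into continuity everywhere, as wanted by the
    integrability criterion. *)
Definition clamp (a b t : R) : R := Rmax a (Rmin b t).

Lemma clamp_in (a b t : R) : a <= b -> a <= clamp a b t <= b.
Proof.
  intro h; unfold clamp; split; [apply Rmax_l|].
  apply Rmax_lub; [exact h|apply Rmin_l].
Qed.

Lemma clamp_id (a b t : R) : a <= t <= b -> clamp a b t = t.
Proof. intro h; unfold clamp; rewrite Rmin_right, Rmax_right; lra. Qed.

Lemma clamp_lipschitz (a b s t : R) : Rabs (clamp a b s - clamp a b t) <= Rabs (s - t).
Proof.
  unfold clamp, Rmax, Rmin, Rabs.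
  repeat (destruct Rle_dec || destruct Rcase_abs); lra.
Qed.

Lemma continuous_clamp {V : UniformSpace} (f : R -> V) (a b : R) :
  a <= b ->
  (forall t, a <= t <= b -> filterlim f (within_segment a b t) (locally (f t))) ->
  forall t, continuous (fun s => f (clamp a b s)) t.
Proof.
  intros hab hf t.
  apply (filterlim_comp _ _ _ (clamp a b) f _ (within_segment a b (clamp a b t)));
    [|apply hf, clamp_in, hab].
  intros P [eps hP]; exists eps; intros s hs.
  apply hP; [|apply clamp_in, hab].
  apply Rle_lt_trans with (2 := hs), clamp_lipschitz.
Qed.

(** The norm is continuous, and polarization expresses the inner product by it. *)
Lemma continuous_inner (H : RealHilbert) (T : UniformSpace) (f g : T -> H) (t : T) :
  continuous f t -> continuous g t -> continuous (fun s => inner (f s) (g s)) t.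
Proof.
  intros hf hg.
  assert (hn : forall h : T -> H, continuous h t -> continuous (fun s => norm (h s) * norm (h s)) t).
  { intros h hh.
    assert (hc : continuous (fun s => norm (h s)) t)
      by (apply (continuous_comp h norm t hh); exact (filterlim_norm (V := H) (h t))).
    apply (continuous_mult (K := R_AbsRing)); exact hc. }
  apply continuous_ext with
    (f := fun s => (norm (plus (f s) (g s)) * norm (plus (f s) (g s))
                    + (- (norm (f s) * norm (f s)) - norm (g s) * norm (g s))) * / 2).
  { intro s.
    assert (e : forall x : H, norm x * norm x = inner x x) by (intro; rewrite inner_self; ring).
    rewrite !e, !inner_plus_l, !inner_plus_r, (inner_sym _ (g s) (f s)).
    match goal with |- ?a = ?b => change (@eq R a b) end; field. }
  apply (continuous_mult (K := R_AbsRing)); [|apply continuous_const].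
  apply (continuous_plus (K := R_AbsRing) (V := R_NormedModule)).
  - apply hn; apply (continuous_plus (K := R_AbsRing) (V := H)); assumption.
  - apply (continuous_minus (K := R_AbsRing) (V := R_NormedModule)); [|apply hn, hg].
    apply (continuous_opp (K := R_AbsRing) (V := R_NormedModule)), hn, hf.
Qed.

Lemma continuous_CK_norm (H : RealHilbert) (p v : R -> H) (t : R) :
  continuous p t -> continuous v t -> norm (p t) < 1 ->
  continuous (fun s => CK_norm (p s) (v s)) t.
Proof.
  intros hp hv hb.
  pose proof (continuous_inner H _ p p t hp hp) as cpp.
  pose proof (continuous_inner H _ v v t hv hv) as cvv.
  pose proof (continuous_inner H _ p v t hp hv) as cpv.
  assert (c1 : continuous (fun s => 1 - inner (p s) (p s)) t).
  { apply (continuous_minus (K := R_AbsRing) (V := R_NormedModule));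
      [apply continuous_const|exact cpp]. }
  apply continuous_ext with (f := fun s =>
     sqrt ((1 - inner (p s) (p s)) * inner (v s) (v s) + inner (p s) (v s) * inner (p s) (v s))
       * / (1 - inner (p s) (p s))).
  { intro s; unfold CK_norm, Rdiv; rewrite !inner_self; do 3 f_equal; ring. }
  apply (continuous_mult (K := R_AbsRing)).
  - apply continuous_sqrt_comp.
    apply (continuous_plus (K := R_AbsRing) (V := R_NormedModule));
      apply (continuous_mult (K := R_AbsRing)); assumption.
  - apply (continuous_comp (fun s => 1 - inner (p s) (p s)) Rinv t c1).
    apply (ex_derive_continuous (K := R_AbsRing) (V := R_NormedModule)); auto_derive.
    rewrite inner_self; pose proof (norm_ge_0 (p t)); nra.
Qed.

Lemma filterlim_velocity (H : RealHilbert) (Fx Fy : C -> H) (gamma g : R -> C)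
    (G : (R -> Prop) -> Prop) (z v : C) :
  Filter G -> continuous Fx z -> continuous Fy z ->
  filterlim gamma G (locally z) -> filterlim g G (locally v) ->
  filterlim (fun t => differential Fx Fy (gamma t) (g t)) G (locally (differential Fx Fy z v)).
Proof.
  intros hG cx cy hgam hg.
  unfold differential.
  eapply filterlim_comp_2; [| |exact (filterlim_plus (V := H) _ _)].
  - eapply filterlim_comp_2; [| |exact (filterlim_scal (V := H) _ _)].
    + eapply filterlim_comp; [exact hg|].
      destruct v as [a b]; apply (continuous_fst a b).
    + eapply filterlim_comp; [exact hgam|exact cx].
  - eapply filterlim_comp_2; [| |exact (filterlim_scal (V := H) _ _)].
    + eapply filterlim_comp; [exact hg|].
      destruct v as [a b]; apply (continuous_snd a b).
    + eapply filterlim_comp; [exact hgam|exact cy].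
Qed.

Lemma C1_on_segment_image (H : RealHilbert) (F Fx Fy : C -> H) (gamma g : R -> C) (a b : R) :
  C1_partials unit_disk F Fx Fy ->
  (forall z, unit_disk z ->
     @filterdiff R_AbsRing C_R_NormedModule H F (locally z) (differential Fx Fy z)) ->
  (forall t, a <= t <= b -> unit_disk (gamma t)) ->
  @C1_on_segment C_R_NormedModule gamma g a b ->
  C1_on_segment (fun t => F (gamma t)) (fun t => differential Fx Fy (gamma t) (g t)) a b.
Proof.
  intros hC1 hF hD hg t ht.
  destruct (hg t ht) as [h1 h2]; pose proof (hD t ht) as hz.
  pose proof (within_segment_proper a b t ht) as hP.
  assert (hPf : Filter (within_segment a b t)) by apply hP.
  assert (hlim : filterlim gamma (within_segment a b t) (locally (gamma t))).
  { apply (filterdiff_continuous_aux (K := R_AbsRing) (U := R_NormedModule)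
      (V := C_R_NormedModule) (F := within_segment a b t) gamma).
    - eexists; exact h1.
    - intros P hl; unfold within_segment, within; revert hl; apply filter_imp; trivial. }
  split.
  - apply (filterdiff_ext_lin (K := R_AbsRing) (U := R_NormedModule) _
      (fun h => differential Fx Fy (gamma t) (scal (V := C_R_NormedModule) h (g t)))).
    + apply (filterdiff_comp (K := R_AbsRing) (U := R_NormedModule) (V := C_R_NormedModule) (W := H)
        gamma F (fun h => scal h (g t)) (differential Fx Fy (gamma t)) h1).
      apply (filterdiff_along (U := C_R_NormedModule) (V := H) F _ (gamma t)); auto.
    + intro h.
      exact (linear_scal (U := C_R_NormedModule) _ (proj1 (hF _ hz)) h (g t)).
  - destruct (hC1 _ hz) as (_ & _ & cx & cy).
    apply filterlim_velocity; assumption.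
Qed.

Lemma breakpoints_in_unit_interval (n : nat) (s : nat -> R) :
  s O = 0 -> s n = 1 -> (forall i, (i < n)%nat -> s i < s (S i)) ->
  forall i, (i <= n)%nat -> 0 <= s i <= 1.
Proof.
  intros h0 h1 hs.
  assert (hle : forall j i, (i <= j)%nat -> (j <= n)%nat -> s i <= s j).
  { induction j as [|j IH]; intros i hij hj.
    - replace i with O by lia; lra.
    - destruct (Nat.eq_dec i (S j)) as [->|hne]; [lra|].
      pose proof (IH i ltac:(lia) ltac:(lia)); pose proof (hs j ltac:(lia)); lra. }
  intros i hi; split.
  - rewrite <- h0; apply hle; lia.
  - rewrite <- h1; apply hle; lia.
Qed.

Lemma ex_RInt_breakpoints (f : R -> R) (n : nat) (s : nat -> R) :
  (forall i, (i < n)%nat -> ex_RInt f (s i) (s (S i))) -> ex_RInt f (s O) (s n).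
Proof.
  induction n as [|n IH]; intro h.
  - apply ex_RInt_point.
  - apply (ex_RInt_Chasles (V := R_NormedModule)) with (s n).
    + apply IH; intros i hi; apply h; lia.
    + apply h; lia.
Qed.

Lemma ex_RInt_CK_segment (H : RealHilbert) (p v : R -> H) (a b : R) :
  a <= b -> C1_on_segment p v a b -> (forall t, a <= t <= b -> norm (p t) < 1) ->
  ex_RInt (fun t => CK_norm (p t) (v t)) a b.
Proof.
  intros hab hp hb.
  apply (ex_RInt_ext (V := R_NormedModule))
    with (f := fun t => CK_norm (p (clamp a b t)) (v (clamp a b t))).
  { rewrite Rmin_left, Rmax_right by exact hab.
    intros t ht; rewrite clamp_id by lra; reflexivity. }
  apply (ex_RInt_continuous (V := R_CompleteNormedModule)); intros t _.
  apply (continuous_CK_norm H (fun t => p (clamp a b t)) (fun t => v (clamp a b t))).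
  - apply (continuous_clamp (V := H) p a b hab); intros u hu.
    pose proof (within_segment_proper a b u hu) as hP.
    assert (hPf : Filter (within_segment a b u)) by apply hP.
    apply (filterdiff_continuous_aux (K := R_AbsRing) (U := R_NormedModule)
      (V := H) (F := within_segment a b u) p).
    + eexists; apply (hp u hu).
    + intros P hl; unfold within_segment, within; revert hl; apply filter_imp; trivial.
  - apply (continuous_clamp (V := H) v a b hab); intros u hu; apply (hp u hu).
  - apply hb, clamp_in, hab.
Qed.

(** The image curve has the same break points, and the comparison of the
    integrands is [klein_poincare_pointwise]. *)
Lemma CK_path_image (H : RealHilbert) (K : R) (F : C -> H) :
  1 <= K ->
  harmonic_on unit_disk F ->
  (forall z, unit_disk z -> unit_ball H (F z)) ->
  (forall z, unit_disk z -> quasiconformal_at K F z) ->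
  forall (z0 z : C) (l : R),
    @is_path_length C_R_NormedModule unit_disk poincare_norm z0 z l ->
    exists l', is_path_length (unit_ball H) CK_norm (F z0) (F z) l' /\ l' <= K * l.
Proof.
  intros hK hharm hB hqc z0 z l (gamma & gamma' & hpw & hD & e0 & e1 & hint).
  destruct (harmonic_conjugate_gradient H F hharm) as (Fx & Fy & hC1 & hF).
  assert (hdiff : forall z, unit_disk z ->
     @filterdiff R_AbsRing C_R_NormedModule H F (locally z) (differential Fx Fy z)).
  { intros w hw; destruct (hC1 w hw) as (hx & hy & _).
    apply (quasiconformal_frame H K F Fx Fy w (hqc w hw) hx hy). }
  set (vel := fun t => differential Fx Fy (gamma t) (gamma' t)).
  destruct hpw as (n & s & s0 & s1 & hs).
  assert (hs01 := breakpoints_in_unit_interval n s s0 s1 (fun i hi => proj1 (hs i hi))).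
  assert (hseg : forall i, (i < n)%nat -> exists g,
     C1_on_segment (fun t => F (gamma t)) g (s i) (s (S i)) /\
     forall t, s i < t < s (S i) -> vel t = g t).
  { intros i hi; destruct (hs i hi) as [hlt (g & hg & eg)].
    exists (fun t => differential Fx Fy (gamma t) (g t)); split.
    - apply C1_on_segment_image; try assumption.
      intros t ht; apply hD.
      pose proof (hs01 i ltac:(lia)); pose proof (hs01 (S i) ltac:(lia)); lra.
    - intros t ht; unfold vel; rewrite eg by exact ht; reflexivity. }
  assert (hex : ex_RInt (fun t => CK_norm (F (gamma t)) (vel t)) 0 1).
  { rewrite <- s0, <- s1; apply ex_RInt_breakpoints; intros i hi.
    destruct (hs i hi) as [hlt _], (hseg i hi) as (g & hg & eg).
    apply (ex_RInt_ext (V := R_NormedModule)) with (f := fun t => CK_norm (F (gamma t)) (g t)).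
    - rewrite Rmin_left, Rmax_right by lra.
      intros t ht; rewrite eg by exact ht; reflexivity.
    - apply (ex_RInt_CK_segment H (fun t => F (gamma t)) g); [lra|exact hg|].
      intros t ht; apply hB, hD.
      pose proof (hs01 i ltac:(lia)); pose proof (hs01 (S i) ltac:(lia)); lra. }
  destruct hex as [l' hl'].
  exists l'; split.
  - exists (fun t => F (gamma t)), vel.
    refine (conj _ (conj _ (conj _ (conj _ hl')))).
    + exists n, s; refine (conj s0 (conj s1 _)); intros i hi.
      split; [apply (hs i hi)|apply hseg, hi].
    + intros t ht; apply hB, hD, ht.
    + rewrite e0; reflexivity.
    + rewrite e1; reflexivity.
  - apply (is_RInt_scal (V := R_NormedModule) _ _ _ K) in hint.
    apply (is_RInt_le _ _ 0 1 _ _ ltac:(lra) hl' hint).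
    intros t ht.
    assert (hDt : unit_disk (gamma t)) by (apply hD; lra).
    apply (klein_poincare_pointwise H K F Fx Fy (gamma t) (gamma' t)); auto; lra.
Qed.

(** If [S] is empty, its infimum is [p_infty] and there is nothing to compare; if
    not, [Glb_Rbar T] is below every [K * l], hence [Glb_Rbar T / K] is a lower
    bound of [S]. *)
Lemma Glb_Rbar_le_mult (S T : R -> Prop) (K : R) :
  0 < K ->
  (forall l, S l -> exists l', T l' /\ l' <= K * l) ->
  Rbar_le (Glb_Rbar T) (Rbar_mult (Finite K) (Glb_Rbar S)).
Proof.
  intros hK h.
  destruct (Glb_Rbar_correct T) as [hT _].
  assert (hle : forall l, S l -> Rbar_le (Glb_Rbar T) (Finite (K * l))).
  { intros l hl; destruct (h l hl) as (l' & hl' & hle).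
    apply Rbar_le_trans with (Finite l'); [apply hT, hl'|exact hle]. }
  destruct (Glb_Rbar_correct S) as [_ hS].
  destruct (Glb_Rbar T) as [r| |].
  - assert (hlb : Rbar_le (Finite (r / K)) (Glb_Rbar S)).
    { apply hS; intros l hl; simpl.
      specialize (hle l hl); simpl in hle.
      apply (Rmult_le_reg_l K); [exact hK|].
      replace (K * (r / K)) with r by (field; lra); exact hle. }
    destruct (Glb_Rbar S) as [d| |].
    + simpl in *.
      apply (Rmult_le_compat_l K) in hlb; [|lra].
      replace (K * (r / K)) with r in hlb by (field; lra); exact hlb.
    + rewrite Rbar_mult_comm, (is_Rbar_mult_unique _ _ _ (is_Rbar_mult_p_infty_pos (Finite K) hK)).
      exact I.
    + destruct hlb.
  - assert (hlb : Rbar_le p_infty (Glb_Rbar S)).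
    { apply hS; intros l hl; exact (hle l hl). }
    destruct (Glb_Rbar S) as [d| |]; try destruct hlb.
    rewrite Rbar_mult_comm, (is_Rbar_mult_unique _ _ _ (is_Rbar_mult_p_infty_pos (Finite K) hK)).
    exact I.
  - exact I.
Qed.

Theorem theorem6p9 :
  forall (H : RealHilbert) (K : R) (F : C -> H),
    1 <= K ->
    harmonic_on unit_disk F ->
    (forall z, unit_disk z -> unit_ball H (F z)) ->
    (forall z, unit_disk z -> quasiconformal_at K F z) ->
    forall z0 z : C, unit_disk z0 -> unit_disk z ->
      Rbar_le (CK_dist (F z0) (F z)) (Rbar_mult (Finite K) (disk_dist z0 z)).
Proof.
  intros H K F hK hharm hB hqc z0 z _ _.
  apply Glb_Rbar_le_mult; [lra|].
  exact (CK_path_image H K F hK hharm hB hqc z0 z).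
Qed.
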